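(* Let $\kappa\ge 0$ be an integer, $d=2\kappa+3$ and $\lambda=\frac{d-2}{2}=\kappa+\frac12$. Then for $-1\le x<1$ the thinplate spline function $k_{d,1}$ of the sphere $\mathbb{S}^{d-1}$ is $$k_{2\kappa+3,1}(x)=\frac{-1}{2\kappa+1}\ln\left(\frac{1-x}{2}\right)+\sum_{\nu=1}^{\kappa}g_\nu^\lambda\,(1-x)^{-\nu}-D_\lambda,$$ where $$g_1^\lambda=\frac{1}{2\kappa+1},\qquad g_\nu^\lambda=2^\nu\binom{\kappa}{\nu}\frac{(\nu-1)!\,(2\kappa-\nu)!}{(2\kappa+1)!}\quad(1<\nu\le\kappa),$$ and $$D_\lambda=\frac{1}{f_{\lambda-\frac12}}\left(\sum_{\nu=1}^{\kappa}g_\nu^\lambda\,G_\lambda^\nu(1)+\frac{1}{2\kappa+1}\,2^{2\kappa+1}(-1)^\kappa\sum_{\nu=0}^{\kappa}\binom{\kappa}{\nu}\frac{(-1)^\nu}{(2\kappa-\nu+1)^2}\right),$$ with $$G_\lambda^\nu(1)=\frac{2^{2\kappa-\nu+1}\,\kappa!\,(\kappa-\nu)!}{(2\kappa-\nu+1)!},\qquad f_\mu=\int_{-1}^1(1-y^2)^\mu\,dy=\frac{\sqrt{\pi}\,\Gamma(\mu+1)}{\Gamma(\mu+3/2)}\quad(\mu>-1).$$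
   Context: The thinplate spline function $k_{d,1}$, with $\lambda=\frac{d-2}{2}$, is defined by the series $$k_{d,1}(x)=\sum_{n=1}^\infty [n(n+d-2)]^{-1}N_{d,n}W_n^\lambda(x),$$ where $N_{d,n}=\binom{n+d-1}{n}-\binom{n+d-3}{n-2}$ (with $\binom{a}{-1}=0$) is the dimension of the space of spherical harmonics of degree $n\ge 1$ on $\mathbb{S}^{d-1}\subset\mathbb{R}^d$, and $W_n^\lambda$ is the Gegenbauer polynomial of order $\lambda$ and degree $n$ normalized so that $W_n^\lambda(1)=1$, i.e. $W_n^\lambda(x)={}_2F_1\left(-n,n+2\lambda;\lambda+\tfrac12;\tfrac{1-x}{2}\right)$. The series is viewed as an orthogonal expansion: with $[f,g]_\lambda=\int_{-1}^1 f(x)g(x)(1-x^2)^{\lambda-\frac12}dx$, $k_{d,1}$ is the function, continuous on $[-1,1)$ and integrable on $[-1,1]$ with respect to the weight $(1-x^2)^{\lambda-\frac12}$, such that $[k_{d,1},W_0^\lambda]_\lambda=0$ and $[k_{d,1},W_n^\lambda]_\lambda/[W_n^\lambda,W_n^\lambda]_\lambda=[n(n+d-2)]^{-1}N_{d,n}$ for $n\ge1$. *)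

(* Defs.v *)
From HB Require Import structures.
From mathcomp Require Import all_boot all_order all_algebra.
From mathcomp Require Import all_classical all_reals all_analysis.

Set Implicit Arguments.
Unset Strict Implicit.
Unset Printing Implicit Defensive.

Import Order.TTheory GRing.Theory Num.Theory.
Import numFieldNormedType.Exports.

Local Open Scope classical_set_scope.
Local Open Scope ring_scope.

Definition pochhammer (R : realType) (a : R) (k : nat) : R :=
  \prod_(i < k) (a + i%:R).

Definition hyp2F1 (R : realType) (a b c z : R) : R :=
  limn (series (fun k : nat =>
    pochhammer a k * pochhammer b k / (pochhammer c k * k`!%:R) * z ^+ k)).

(* W_n^lambda, normalized by W_n^lambda(1) = 1. *)
Definition gegenbauer (R : realType) (lambda : R) (n : nat) (x : R) : R :=
  hyp2F1 (- n%:R) (n%:R + 2 * lambda) (lambda + 1 / 2) ((1 - x) / 2).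

Definition sphere_order (R : realType) (d : nat) : R := (d%:R - 2) / 2.

(* N_{d,n}, for n >= 1 and d >= 2.  The case split implements the convention
   'C(a, -1) = 0, which the truncated subtraction n - 2 would break at n = 1. *)
Definition dim_harmonics (R : realType) (d n : nat) : R :=
  'C((n + d - 1)%N, n)%:R
  - (if (2 <= n)%N then 'C((n + d - 3)%N, (n - 2)%N)%:R else 0).

Definition gegenbauer_weight (R : realType) (lambda x : R) : R :=
  (1 - x ^+ 2) `^ (lambda - 1 / 2).

Definition gegenbauer_dot (R : realType) (lambda : R) (f g : R -> R) : R :=
  \int[@lebesgue_measure R]_(x in `[-1, 1])
    (f x * g x * gegenbauer_weight lambda x).

(* k is the thinplate spline function k_{d,1} of the sphere S^(d-1): the
   integrable function with Gegenbauer expansion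
     sum_(n >= 1) (n (n + d - 2))^-1 N_{d,n} W_n^lambda, lambda = (d - 2) / 2.
   Only the values of k on [-1, 1[ matter. *)
Definition is_thinplate_spline (R : realType) (d : nat) (k : R -> R) : Prop :=
  let lambda := sphere_order R d in
  [/\ {within `[-1, 1[, continuous k},
      (@lebesgue_measure R).-integrable `[-1, 1]
        (fun x => (k x * gegenbauer_weight lambda x)%:E),
      gegenbauer_dot lambda k (gegenbauer lambda 0) = 0 &
      forall n : nat, (1 <= n)%N ->
        gegenbauer_dot lambda k (gegenbauer lambda n) /
        gegenbauer_dot lambda (gegenbauer lambda n) (gegenbauer lambda n)
        = (n%:R * (n%:R + d%:R - 2))^-1 * dim_harmonics R d n].

Definition Gamma (R : realType) (a : R) : R :=
  \int[@lebesgue_measure R]_(t in `]0, +oo[) (t `^ (a - 1) * expR (- t)).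

(* f_mu *)
Definition weight_mass (R : realType) (mu : R) : R :=
  \int[@lebesgue_measure R]_(y in `[-1, 1]) ((1 - y ^+ 2) `^ mu).

(* g_nu^lambda for lambda = kappa + 1/2 and 1 <= nu <= kappa; all natural
   number subtractions below are exact in that range. *)
Definition spline_coef (R : realType) (kappa nu : nat) : R :=
  if nu == 1%N then ((2 * kappa + 1)%N)%:R^-1
  else 2 ^+ nu * 'C(kappa, nu)%:R *
       (((nu - 1)`! * (2 * kappa - nu)`!)%N%:R / ((2 * kappa + 1)`!)%:R).

(* G_lambda^nu(1) for lambda = kappa + 1/2 and 1 <= nu <= kappa. *)
Definition spline_G1 (R : realType) (kappa nu : nat) : R :=
  2 ^+ (2 * kappa - nu + 1) * (kappa`! * (kappa - nu)`!)%N%:R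
  / ((2 * kappa - nu + 1)`!)%:R.

(* D_lambda for lambda = kappa + 1/2. *)
Definition spline_const (R : realType) (kappa : nat) : R :=
  (weight_mass (sphere_order R (2 * kappa + 3) - 1 / 2))^-1 *
  (\sum_(1 <= nu < kappa.+1) spline_coef R kappa nu * spline_G1 R kappa nu
   + ((2 * kappa + 1)%N)%:R^-1 * 2 ^+ (2 * kappa + 1) * (-1) ^+ kappa *
     \sum_(0 <= nu < kappa.+1)
        'C(kappa, nu)%:R * ((-1) ^+ nu / ((2 * kappa - nu + 1)%N)%:R ^+ 2)).

(* Main.v *)
Require Import Defs.
From HB Require Import structures.
From mathcomp Require Import all_boot all_order all_algebra.
From mathcomp Require Import all_classical all_reals all_analysis.
From mathcomp Require Import measurable_realfun ring lra zify.

Set Implicit Arguments.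
Unset Strict Implicit.
Unset Printing Implicit Defensive.

Import Order.TTheory GRing.Theory Num.Theory.
Import numFieldNormedType.Exports.

Local Open Scope classical_set_scope.
Local Open Scope ring_scope.

(** Write s = (1 - x)/2. The weight (1 - x^2)^kappa is 4^kappa w(s), with
    w = s^kappa (1 - s)^kappa, and the right-hand side of the formula multiplied
    by w is A(s) + B(s) ln s for polynomials A and B. All the integrals of the
    expansion are therefore values of the two linear functionals [polyint] and
    [polylnint] (the integrals over [0, 1] of p and of p ln), and the analysis
    needed to evaluate them is confined to [integral_poly_ln]. What remains is algebra in {poly R}, based on
    [polyint_deriv] (fundamental theorem of calculus) and [polylnint_deriv]
    (integration by parts against ln).

    Put p = s (1 - s) w. The Gegenbauer polynomial F of degree n satisfies
    (p F')' = - lambda w F with lambda = n (n + d - 2)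
    ([gegen_poly_self_adjoint]), and the recurrence satisfied by the g_nu says
    exactly that k, the right-hand side of the formula, satisfies (p k')' = w
    ([flux_poly_ode]): k is a fundamental solution of the Laplace-Beltrami
    operator, up to a constant. Green's formula applied to k and F gives
    lambda * int k w F = int w, because only the singularity at s = 0 contributes
    a boundary term ([spline_moment]). On the other hand
    N_{d,n} * int w F^2 = int w ([dim_harmonics_norm]); the quotient of the two
    relations is the required coefficient N_{d,n} / (n (n + d - 2)). The constant
    D_lambda is the one that makes the mean of k vanish ([spline_mean]).

    Conversely, if two functions have the same coefficients, their difference
    times the weight is integrable and orthogonal to all polynomials. Powers of a
    polynomial peaked on a small interval show that it cannot be positive anywhere
    on [-1, 1[, where it is continuous ([moments_eq0_no_bump],
    [thinplate_spline_unique]).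

    The formula for f_mu follows by integrating (r - x^2)^mu exp(- r) over the
    set x^2 < r in the two possible orders ([eweight_mass_gamma]): first in r it is
    the Gauss integral times Gamma(mu + 1), first in x it is f_mu times
    Gamma(mu + 3/2). *)

(** * Affine substitutions and an improper fundamental theorem of calculus *)

Section Affine.
Context {R : realType}.
Notation mu := (@lebesgue_measure R).

Definition affine (c b : R) : measurableTypeR R -> measurableTypeR R :=
  fun x => c * x + b.

Lemma continuous_affine (c b : R) : continuous (fun x : R => c * x + b).
Proof.
move=> x.
by apply: cvgD; [apply: cvgM; [exact: cvg_cst|exact: cvg_id]|exact: cvg_cst].
Qed.

Lemma measurable_affine (c b : R) : measurable_fun setT (affine c b).
Proof. exact: continuous_measurable_fun (@continuous_affine c b). Qed.

(** Both sides are measures that agree on the half-open intervals. *)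
Lemma lebesgue_measure_affine (c b : R) (A : set (measurableTypeR R)) :
  c != 0 -> measurable A ->
  mu A = (`|c|%:E * pushforward mu (affine c b) A)%E.
Proof.
move=> c0 mA.
pose m : {measure set (measurableTypeR R) -> \bar R} :=
  mscale (NngNum (normr_ge0 c)) (pushforward mu (affine c b)).
apply: (lebesgue_measure_unique (mu := m (@measurable_affine c b))) => //= _
  [[u v]] _ <-.
change (mu `]u, v] = `|c|%:E * mu (affine c b @^-1` `]u, v]))%E.
move: c0; rewrite neq_lt => /orP[c0|c0].
- have -> : affine c b @^-1` `]u, v] = `[(v - b) / c, (u - b) / c[%classic.
    apply/seteqP; split => x; rewrite /affine /= !in_itv /= => /andP[h1 h2].
      by rewrite ler_ndivrMr// ltr_ndivlMr// ltrBlDr lerBrDr mulrC h1 andbT.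
    move: h1 h2; rewrite ler_ndivrMr// ltr_ndivlMr// ltrBlDr lerBrDr mulrC.
    by move=> -> ->.
  rewrite !lebesgue_measure_itv /= !lte_fin ltr_nM2r ?invr_lt0// ltrD2r.
  case: ifP => _; last by rewrite mule0.
  rewrite ltr0_norm// -!EFinB -EFinM; congr EFin.
  by field; rewrite lt_eqF.
- have -> : affine c b @^-1` `]u, v] = `](u - b) / c, (v - b) / c]%classic.
    apply/seteqP; split => x; rewrite /affine /= !in_itv /= => /andP[h1 h2].
      by rewrite ltr_pdivrMr// ler_pdivlMr// ltrBlDr lerBrDr mulrC h1.
    move: h1 h2; rewrite ltr_pdivrMr// ler_pdivlMr// ltrBlDr lerBrDr mulrC.
    by move=> -> ->.
  rewrite !lebesgue_measure_itv /= !lte_fin ltr_pM2r ?invr_gt0// ltrD2r.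
  case: ifP => _; last by rewrite mule0.
  rewrite gtr0_norm// -!EFinB -EFinM; congr EFin.
  by field; rewrite gt_eqF.
Qed.

Lemma ge0_integral_affine (c b : R) (D : set R) (f : R -> \bar R) : c != 0 ->
  measurable D -> measurable_fun D f -> (forall x, D x -> 0 <= f x)%E ->
  (\int[mu]_(x in D) f x =
   `|c|%:E * \int[mu]_(x in [set x | D (c * x + b)%R]) f (c * x + b)%R)%E.
Proof.
move=> c0 mD mf f0.
have mDc : measurable [set x : R | D (c * x + b)].
  by have := @measurable_affine c b measurableT D mD; rewrite setTI.
pose m : {measure set (measurableTypeR R) -> \bar R} :=
  pushforward mu (affine c b).
have -> : (\int[mu]_(x in D) f x =
    \int[mscale (NngNum (normr_ge0 c)) (m (@measurable_affine c b))]_(x in D)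
      f x)%E.
  apply: eq_measure_integral => A mA _.
  exact: lebesgue_measure_affine.
rewrite ge0_integral_mscale//; congr (_ * _)%E.
rewrite (ge0_integral_pushforward (@measurable_affine c b))// => y.
by rewrite inE; exact: f0.
Qed.

End Affine.

Section ImproperFTC.
Context {R : realType}.
Notation mu := (@lebesgue_measure R).

(** The integrand may be unbounded at the left end point: the integrals over
    [a + (b - a)/(n + 2), b] converge monotonically. *)
Lemma ge0_FTC2_left_open (f F : R -> R) (a b : R) : a < b ->
  (forall x, a < x -> {for x, continuous f}) ->
  (forall x, a < x <= b -> 0 <= f x) ->
  (forall x, a < x -> is_derive x 1 F (f x)) ->
  F x @[x --> a^'+] --> F a ->
  (\int[mu]_(x in `]a, b]) (f x)%:E = (F b - F a)%:E)%E.
Proof.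
move=> ab cf f0 dF Fa.
pose u n := a + (b - a) / n.+2%:R.
have ba0 : 0 < b - a by rewrite subr_gt0.
have ua n : a < u n by rewrite /u ltrDl divr_gt0.
have ub n : u n < b.
  by rewrite /u -ltrBrDl ltr_pdivrMr// ltr_pMr// ltr1n.
have u_cvg : u n @[n --> \oo] --> a.
  rewrite -[X in _ --> X]addr0; apply: cvgD; first exact: cvg_cst.
  rewrite -(mulr0 (b - a)); apply: cvgM; first exact: cvg_cst.
  have := @cvg_harmonic R; rewrite -cvg_shiftS; exact.
pose E n := `[u n, b]%classic.
have -> : `]a, b]%classic = \bigcup_n E n.
  apply/seteqP; split => x.
    rewrite /= in_itv/= => /andP[ax xb].
    have /cvgrPdist_lt/(_ _ (_ : 0 < x - a)) := u_cvg.
    rewrite subr_gt0 => /(_ ax)[n _ /(_ n (leqnn n))] /=.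
    rewrite distrC ger0_norm ?subr_ge0 ?ltW// ltrD2r => unx.
    by exists n => //; rewrite /E /= in_itv/= ltW.
  move=> [n _]; rewrite /E/= !in_itv/= => /andP[h ->].
  by rewrite (lt_le_trans (ua n) h).
have cfE n : {within E n, continuous f}.
  apply: continuous_in_subspaceT => x.
  rewrite inE /E /= in_itv/= => /andP[h _]; apply: cf.
  exact: lt_le_trans h.
have EF n : (\int[mu]_(x in E n) (f x)%:E = (F b - F (u n))%:E)%E.
  rewrite EFinB; apply: continuous_FTC2 (cfE n) _ _ => //.
  - have cF x : a < x -> {for x, continuous F}.
      move=> ax; apply/differentiable_continuous/derivable1_diffP.
      by have := dF x ax => -[].
    split => [x| |].
    + rewrite in_itv/= => /andP[h _].
      by have := dF x (lt_trans (ua n) h) => -[].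
    + by apply: cvg_at_right_filter; exact: cF.
    + by apply: cvg_at_left_filter; exact: cF.
  - move=> x; rewrite in_itv/= => /andP[h _].
    have := dF x (lt_trans (ua n) h) => dFx.
    by rewrite derive1E derive_val.
have ndE : nondecreasing_seq E.
  move=> m n mn; rewrite subsetEset => x; rewrite /E /= !in_itv/= => /andP[h ->].
  rewrite andbT; apply: le_trans h; rewrite /u lerD2l ler_pM2l// lef_pV2 ?posrE//.
  by rewrite ler_nat.
have Ef0 n x : E n x -> (0 <= (f x)%:E)%E.
  rewrite /E/= in_itv/= lee_fin => /andP[h xb].
  by rewrite f0// xb (lt_le_trans (ua n) h).
have mf n : measurable_fun (E n) (EFin \o f).
  apply/measurable_EFinP; apply: (@subspace_continuous_measurable_fun R (E n)).
    exact: measurable_itv.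
  exact: cfE.
have lim2 : (\int[mu]_(x in E n) (f x)%:E)%E @[n --> \oo] --> (F b - F a)%:E.
  under eq_cvg do rewrite EF.
  apply: cvg_EFin; first exact: nearW.
  apply: cvgB; first exact: cvg_cst.
  by have /cvg_at_rightP := Fa; apply.
have := @ge0_nondecreasing_set_cvg_integral _ (measurableTypeR R) R E (EFin \o f)
  mu ndE (fun=> measurable_itv _) mf Ef0.
by move=> h; exact: (cvg_unique _ h lim2).
Qed.

End ImproperFTC.

(** * Integrals of s^m and s^m ln s *)

Section Moments.
Context {R : realType}.
Notation mu := (@lebesgue_measure R).

(** From ln (1/y) < 1/y applied to the square root y of x. *)
Lemma norm_mul_ln_le (x : R) : 0 < x -> x <= 1 -> `|x * ln x| <= 2 * Num.sqrt x.
Proof.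
move=> x0 x1; have sx0 : 0 < Num.sqrt x by rewrite sqrtr_gt0.
have xE : x = Num.sqrt x ^+ 2 by rewrite sqr_sqrtr// ltW.
set y := Num.sqrt x in sx0 xE *.
have lny : - ln y < y^-1 by rewrite -lnV ?posrE// ln_sublinear// invr_gt0.
rewrite normrM gtr0_norm// ler0_norm ?ln_le0// xE lnXn//.
have -> : y ^+ 2 * - (ln y *+ 2) = 2 * (y ^+ 2 * - ln y) by ring.
rewrite ler_pM2l//; apply: le_trans (ler_wpM2l _ (ltW lny)) _.
  by rewrite exprn_ge0// ltW.
by rewrite expr2 mulfK// gt_eqF.
Qed.

Lemma cvg_expS_ln (m : nat) : x ^+ m.+1 * ln x @[x --> (0:R)^'+] --> (0:R).
Proof.
have s0 : 2 * Num.sqrt x @[x --> (0:R)^'+] --> (0:R).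
  rewrite -[X in _ --> X](mulr0 2) -[X in 2 * X](@sqrtr0 R).
  apply: cvgM; first exact: cvg_cst.
  apply: cvg_at_right_filter; exact: sqrt_continuous.
apply/norm_cvg0P.
apply: (squeeze_cvgr _ (cvg_cst 0) s0).
near=> x.
have x0 : 0 < x by near: x; exact: nbhs_right_gt.
have x1 : x <= 1 by near: x; exact: nbhs_right_le.
rewrite /= normr_ge0/= exprSr -mulrA normrM.
apply: le_trans (norm_mul_ln_le x0 x1).
rewrite ler_piMl// normrX exprn_ile1// ?normr_ge0//.
by rewrite gtr0_norm.
Unshelve. all: by end_near. Qed.

Lemma integral_expn01 (m : nat) :
  (\int[mu]_(x in `]0%R, 1%R]) (x ^+ m)%:E = (m.+1%:R^-1)%:E)%E.
Proof.
pose F (x : R) := m.+1%:R^-1 * x ^+ m.+1.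
have dF (x : R) : 0 < x -> is_derive x 1 F (x ^+ m).
  move=> _; have -> : F = m.+1%:R^-1 \*: (@id R ^+ m.+1).
    by apply/funext => y; rewrite /F !fctE.
  apply: is_derive_eq.
  by rewrite /= /GRing.scale /= mulr1 mulKf// pnatr_eq0.
rewrite (ge0_FTC2_left_open ltr01 _ _ dF)//.
- by rewrite /F expr1n expr0n /= mulr0 mulr1 subr0.
- by move=> x _; exact: exprn_continuous.
- by move=> x /andP[/ltW ? _]; rewrite exprn_ge0.
- apply: cvg_at_right_filter; apply: cvgM; first exact: cvg_cst.
  exact: exprn_continuous.
Qed.

Lemma integral_expn_ln01 (m : nat) :
  (\int[mu]_(x in `]0%R, 1%R]) (x ^+ m * - ln x)%:E = (m.+1%:R^-2)%:E)%E.
Proof.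
pose c : R := m.+1%:R^-1.
pose F (x : R) := c ^+ 2 * x ^+ m.+1 - c * (x ^+ m.+1 * ln x).
have dF (x : R) : 0 < x -> is_derive x 1 F (x ^+ m * - ln x).
  move=> x0.
  have -> : F = (c ^+ 2 \*: (@id R ^+ m.+1)) - c \*: ((@id R ^+ m.+1) * @ln R).
    by apply/funext => y; rewrite /F !fctE.
  have dln := is_derive1_ln x0.
  apply: is_derive_eq.
  rewrite /= /GRing.scale /=.
  rewrite !fctE /= (exprS x) /c; move: (ln x) (x ^+ m) => l y.
  have N0 : m.+1%:R != 0 :> R by rewrite pnatr_eq0.
  by set N : R := m.+1%:R in N0 *; field; apply/andP; split; rewrite ?gt_eqF.
rewrite (ge0_FTC2_left_open ltr01 _ _ dF)//.
- by rewrite /F expr1n expr0n /= ln1 !(mulr0, mul0r, mulr1) !subr0 exprVn.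
- move=> x x0; apply: cvgM; first exact: exprn_continuous.
  by apply: cvgN; exact: continuous_ln.
- move=> x /andP[/ltW ? x1]; rewrite mulr_ge0 ?exprn_ge0//.
  by rewrite oppr_ge0 ln_le0.
- rewrite /F expr0n /= mul0r !mulr0 subr0.
  rewrite -[X in _ --> X](_ : c ^+ 2 * 0 - c * 0 = 0); last by rewrite !mulr0 subr0.
  apply: cvgB.
    apply: cvgM; first exact: cvg_cst.
    rewrite -[X in _ --> X](_ : (0 : R) ^+ m.+1 = 0); last by rewrite expr0n.
    by apply: cvg_at_right_filter; exact: exprn_continuous.
  by apply: cvgM; [exact: cvg_cst|exact: cvg_expS_ln].
Qed.

End Moments.

Section PolyLogIntegrals.
Context {R : realType}.
Notation mu := (@lebesgue_measure R).

Lemma Rintegral_lin_sum (D : set (measurableTypeR R)) (n : nat) (c : nat -> R)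
    (f : nat -> R -> R) :
  measurable D -> (forall i, mu.-integrable D (EFin \o f i)) ->
  mu.-integrable D (EFin \o (fun x => \sum_(i < n) c i * f i x)) /\
  \int[mu]_(x in D) (\sum_(i < n) c i * f i x) =
    \sum_(i < n) c i * \int[mu]_(x in D) f i x.
Proof.
move=> mD fi; elim: n => [|n [IHi IHe]].
  split.
    apply: (@eq_integrable _ _ _ _ _ mD (cst 0) _ _ (integrable0 _ _)) => // x _.
    by rewrite /= big_ord0.
  rewrite big_ord0; under eq_Rintegral do rewrite big_ord0.
  by rewrite Rintegral_cst// mul0r.
have cfi : mu.-integrable D (EFin \o (fun x => c n * f n x)).
  by apply: (eq_integrable mD _ _ _ (integrableZl mD (c n) (fi n))).
split.
  apply: (eq_integrable mD _ _ _ (integrableD mD IHi cfi)) => // x _.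
  by rewrite /= big_ord_recr.
under eq_Rintegral do rewrite big_ord_recr.
by rewrite RintegralD// IHe RintegralZl// big_ord_recr.
Qed.

Let halve (x : R) : (1 - x) / 2 = - 2^-1 * x + 2^-1.
Proof. by field. Qed.

Lemma ge0_integral_half (f : R -> R) (v : R) :
  measurable_fun setT f -> (forall s, 0 < s <= 1 -> 0 <= f s) ->
  (\int[mu]_(x in `]0%R, 1%R]) (f x)%:E = v%:E)%E ->
  (\int[mu]_(x in `[(-1)%R, 1%R]) (f ((1 - x) / 2)%R)%:E = (2 * v)%:E)%E.
Proof.
move=> mf f0.
rewrite (@ge0_integral_affine _ (- 2^-1) (2^-1)); last first.
- by move=> x /=; rewrite in_itv/= lee_fin; exact: f0.
- by apply/measurable_EFinP; exact: measurable_funTS.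
- exact: measurable_itv.
- by rewrite oppr_eq0 invr_eq0 pnatr_eq0.
have -> : [set x : R | `]0, 1]%classic (- 2^-1 * x + 2^-1)] = `[-1, 1[%classic.
  apply/seteqP; split => x; rewrite /= !in_itv/= => /andP[h1 h2]; lra.
rewrite integral_itv_bndo_bndc; last first.
  apply/measurable_EFinP; apply: measurable_funTS.
  exact: measurableT_comp (@measurable_affine _ _ _).
under eq_integral do rewrite -halve.
rewrite normrN ger0_norm ?invr_ge0// => e.
by rewrite EFinM -e muleA -EFinM divff ?pnatr_eq0// mul1e.
Qed.

Lemma measurable_half (f : R -> R) (D : set R) : measurable_fun setT f ->
  measurable_fun D (fun x => f ((1 - x) / 2)).
Proof.
move=> mf; apply: measurable_funTS; under eq_fun do rewrite halve.
exact: measurableT_comp (@measurable_affine _ _ _).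
Qed.

Lemma ge0_Rintegral_half (f : R -> R) (v : R) :
  measurable_fun setT f -> (forall s, 0 <= s <= 1 -> 0 <= f s) ->
  (\int[mu]_(x in `]0%R, 1%R]) (f x)%:E = v%:E)%E ->
  mu.-integrable `[-1, 1] (EFin \o (fun x => f ((1 - x) / 2))) /\
  \int[mu]_(x in `[-1, 1]) f ((1 - x) / 2) = 2 * v.
Proof.
move=> mf f0 e.
have e2 := ge0_integral_half mf _ e; split.
  apply/integrableP; split.
    by apply/measurable_EFinP; exact: measurable_half.
  rewrite (_ : (\int[mu]_(x in `[(-1)%R, 1%R]) `|_| = (2 * v)%:E)%E) ?ltry//.
  rewrite -e2; last by move=> s /andP[/ltW s0 s1]; rewrite f0// s0.
  apply: eq_integral => x; rewrite inE/= in_itv/= => xi.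
  by rewrite /= ger0_norm// f0//; lra.
by rewrite /Rintegral e2// => s /andP[/ltW s0 s1]; rewrite f0// s0.
Qed.

Lemma Rintegral_halfX (m : nat) :
  mu.-integrable `[-1, 1] (EFin \o (fun x : R => ((1 - x) / 2) ^+ m)) /\
  \int[mu]_(x in `[-1, 1]) ((1 - x) / 2) ^+ m = 2 * m.+1%:R^-1.
Proof.
apply: (@ge0_Rintegral_half (fun s => s ^+ m)).
- exact: exprn_measurable.
- by move=> s /andP[? _]; rewrite exprn_ge0.
- exact: integral_expn01.
Qed.

Lemma Rintegral_halfX_ln (m : nat) :
  mu.-integrable `[-1, 1]
    (EFin \o (fun x : R => ((1 - x) / 2) ^+ m * ln ((1 - x) / 2))) /\
  \int[mu]_(x in `[-1, 1]) (((1 - x) / 2) ^+ m * ln ((1 - x) / 2))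
    = 2 * - m.+1%:R^-2.
Proof.
have [i e] : mu.-integrable `[-1, 1]
    (EFin \o (fun x : R => ((1 - x) / 2) ^+ m * - ln ((1 - x) / 2))) /\
  \int[mu]_(x in `[-1, 1]) (((1 - x) / 2) ^+ m * - ln ((1 - x) / 2))
    = 2 * m.+1%:R^-2.
  apply: (@ge0_Rintegral_half (fun s => s ^+ m * - ln s)).
  - apply: measurable_funM; first exact: exprn_measurable.
    by apply: measurableT_comp => //; exact: measurable_ln.
  - by move=> s /andP[? ?]; rewrite mulr_ge0 ?exprn_ge0// oppr_ge0 ln_le0.
  - exact: integral_expn_ln01.
have E x : ((1 - x) / 2) ^+ m * ln ((1 - x) / 2) =
    -1 * (((1 - x) / 2) ^+ m * - ln ((1 - x) / 2)).
  by rewrite mulrN mulrNN mul1r.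
have mI : measurable (`[-1, 1]%classic : set (measurableTypeR R)).
  exact: measurable_itv.
split.
  apply: (eq_integrable mI _ _ _ (integrableZl mI (-1) i)) => // x _.
  by rewrite /= -EFinM -E.
under eq_Rintegral do rewrite E.
by rewrite RintegralZl// e mulN1r mulrN.
Qed.

(** The integrals over [0, 1] of p(s) and of p(s) ln s, evaluated monomial by
    monomial. *)
Definition polyint (p : {poly R}) : R := \sum_(i < size p) p`_i * i.+1%:R^-1.
Definition polylnint (p : {poly R}) : R := \sum_(i < size p) p`_i * - i.+1%:R^-2.

(** The factor 2 is the Jacobian of x = 1 - 2 s. *)
Lemma integral_poly_ln (A B : {poly R}) :
  mu.-integrable `[-1, 1]
    (EFin \o (fun x : R => A.[(1 - x) / 2] + B.[(1 - x) / 2] * ln ((1 - x) / 2)))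
  /\
  \int[mu]_(x in `[-1, 1])
      (A.[(1 - x) / 2] + B.[(1 - x) / 2] * ln ((1 - x) / 2))
    = 2 * (polyint A + polylnint B).
Proof.
have mI : measurable (`[-1, 1]%classic : set (measurableTypeR R)).
  exact: measurable_itv.
have [Ai Ae] := Rintegral_lin_sum (size A) (fun i => A`_i) mI
  (fun m => (Rintegral_halfX m).1).
have [Bi Be] := Rintegral_lin_sum (size B) (fun i => B`_i) mI
  (fun m => (Rintegral_halfX_ln m).1).
have E x : A.[(1 - x) / 2] + B.[(1 - x) / 2] * ln ((1 - x) / 2) =
  \sum_(i < size A) A`_i * ((1 - x) / 2) ^+ i +
  \sum_(i < size B) B`_i * (((1 - x) / 2) ^+ i * ln ((1 - x) / 2)).
  rewrite !horner_coef mulr_suml; congr (_ + _).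
  by apply: eq_bigr => i _; rewrite mulrA.
split.
  by apply: (eq_integrable mI _ _ _ (integrableD mI Ai Bi)) => // x _; rewrite /= E.
under eq_Rintegral do rewrite E.
rewrite RintegralD// Ae Be mulrDr /polyint /polylnint !mulr_sumr.
congr (_ + _); apply: eq_bigr => i _.
  by rewrite (Rintegral_halfX i).2 mulrCA.
by rewrite (Rintegral_halfX_ln i).2 mulrCA.
Qed.

End PolyLogIntegrals.

(** * The integration functionals on polynomials *)

Section PolynomialIntegrals.
Context {R : realType}.
Implicit Types p q : {poly R}.

Lemma polyint_wide (n : nat) p : (size p <= n)%N ->
  polyint p = \sum_(i < n) p`_i * i.+1%:R^-1.
Proof.
move=> pn; rewrite /polyint (big_ord_widen n (fun i => p`_i * i.+1%:R^-1) pn).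
rewrite big_mkcond /=; apply: eq_bigr => i _; case: ifPn => //.
by rewrite -leqNgt => si; rewrite nth_default ?mul0r.
Qed.

Lemma polylnint_wide (n : nat) p : (size p <= n)%N ->
  polylnint p = \sum_(i < n) p`_i * - i.+1%:R^-2.
Proof.
move=> pn; rewrite /polylnint (big_ord_widen n (fun i => p`_i * - i.+1%:R^-2) pn).
rewrite big_mkcond /=; apply: eq_bigr => i _; case: ifPn => //.
by rewrite -leqNgt => si; rewrite nth_default ?mul0r.
Qed.

Fact polyint_is_linear : scalar (@polyint R).
Proof.
move=> a p q; pose n := maxn (size (a *: p + q)) (maxn (size p) (size q)).
rewrite !(@polyint_wide n) ?leq_max ?leqnn ?orbT//.
rewrite mulr_sumr -big_split; apply: eq_bigr => i _ /=.
by rewrite coefD coefZ mulrDl mulrA.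
Qed.
HB.instance Definition _ :=
  GRing.isLinear.Build R {poly R} R *%R (@polyint R) polyint_is_linear.

Fact polylnint_is_linear : scalar (@polylnint R).
Proof.
move=> a p q; pose n := maxn (size (a *: p + q)) (maxn (size p) (size q)).
rewrite !(@polylnint_wide n) ?leq_max ?leqnn ?orbT//.
rewrite mulr_sumr -big_split; apply: eq_bigr => i _ /=.
by rewrite coefD coefZ mulrDl mulrA.
Qed.
HB.instance Definition _ :=
  GRing.isLinear.Build R {poly R} R *%R (@polylnint R) polylnint_is_linear.

Lemma polyintZ (a : R) p : polyint (a *: p) = a * polyint p.
Proof. exact: linearZ. Qed.

Lemma polylnintZ (a : R) p : polylnint (a *: p) = a * polylnint p.
Proof. exact: linearZ. Qed.

Lemma polyint_deriv p : polyint p^`() = p.[1] - p.[0].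
Proof.
have s : (size p^`() <= size p)%N.
  by apply/leq_sizeP => j pj; rewrite coef_deriv nth_default ?mul0rn// leqW.
rewrite (polyint_wide s).
rewrite horner_coef0 (@horner_coef_wide _ (size p).+1)//.
rewrite big_ord_recl /= expr0 mulr1 addrC addKr.
apply: eq_bigr => i _; rewrite coef_deriv expr1n mulr1 -[p`__ *+ _]mulr_natr.
by rewrite mulfK// pnatr_eq0.
Qed.

Lemma polylnint_deriv p : polylnint ('X * p)^`() = - polyint p.
Proof.
have s : (size ('X * p)^`() <= size p)%N.
  by apply/leq_sizeP => j pj; rewrite coef_deriv coefXM /= nth_default ?mul0rn.
rewrite (polylnint_wide s) /polyint -sumrN; apply: eq_bigr => i _.
rewrite coef_deriv coefXM /= -[p`__ *+ _]mulr_natr -mulrA -mulrN; congr (_ * _).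
have : i.+1%:R != 0 :> R by rewrite pnatr_eq0.
by move: (i.+1%:R) => y y0; field.
Qed.

Lemma polylnintXn (m : nat) : polylnint ('X^m : {poly R}) = - m.+1%:R^-2.
Proof.
rewrite (@polylnint_wide m.+1) ?size_polyXn// big_ord_recr big1 /= => [|i _].
  by rewrite coefXn eqxx mul1r add0r.
by rewrite coefXn ltn_eqF ?mul0r.
Qed.

(** Euler's Beta integral for integer exponents, by induction on b: the derivative
    of X^(a+1) (1 - X)^(b+1) integrates to 0. *)
Lemma polyint_beta (a b : nat) :
  polyint ('X^a * (1 - 'X) ^+ b : {poly R}) = (a`! * b`!)%:R / (a + b).+1`!%:R.
Proof.
have f0 n : (n`!%:R != 0 :> R) by rewrite pnatr_eq0 -lt0n fact_gt0.
have s0 n : (n.+1%:R != 0 :> R) by rewrite pnatr_eq0.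
elim: b a => [|b IH] a.
  have -> : 'X^a * (1 - 'X) ^+ 0 = (a.+1%:R^-1 *: 'X^(a.+1))^`() :> {poly R}.
    rewrite expr0 mulr1 derivZ derivXn /= -['X^a *+ _]scaler_nat scalerA.
    by rewrite mulVf ?scale1r.
  rewrite addn0 fact0 muln1 polyint_deriv !hornerE expr1n expr0n /= mulr0 subr0 mulr1.
  rewrite factS natrM; move: (s0 a) (f0 a); move: (a.+1%:R) (a`!%:R) => x y x0 y0.
  by field; rewrite x0 y0.
have e : a.+1%:R * polyint ('X^a * (1 - 'X) ^+ b.+1 : {poly R}) =
    b.+1%:R * polyint ('X^(a.+1) * (1 - 'X) ^+ b : {poly R}).
  apply/eqP; rewrite -subr_eq0 -!linearZ -linearB /=; apply/eqP.
  transitivity (polyint ('X^(a.+1) * (1 - 'X) ^+ b.+1 : {poly R})^`()).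
    congr polyint; rewrite derivM derivXn deriv_exp derivB derivC derivX /=.
    by rewrite !scaler_nat; ring.
  by rewrite polyint_deriv !hornerE expr0n subrr expr0n /= !(mul0r, mulr0) subrr.
have := IH a.+1; rewrite addSnnS => e2.
apply: (mulfI (s0 a)); rewrite e e2.
move: ((a + b.+1).+1`!%:R) => x.
rewrite (factS a) (factS b) !natrM.
by move: (a`!%:R) (b`!%:R) (a.+1%:R) (b.+1%:R) => y z u v; ring.
Qed.

End PolynomialIntegrals.

(** * Gegenbauer polynomials *)

Section GegenbauerPolynomial.
Context {R : realType}.

Definition gegen_coef (kappa n j : nat) : R :=
  pochhammer (- n%:R) j * pochhammer (n + 2 * kappa + 1)%:R j
  / (pochhammer kappa.+1%:R j * j`!%:R).

(** Gegenbauer's polynomial of order [kappa + 1/2] in the variable (1 - x)/2. *)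
Definition gegen_poly (kappa n : nat) : {poly R} :=
  \poly_(j < n.+1) gegen_coef kappa n j.

Definition gegen_eigen (kappa n : nat) : R := (n * (n + 2 * kappa + 1))%:R.

(** Up to the factor 4^kappa, the weight (1 - x^2)^kappa in the variable
    (1 - x)/2. *)
Definition jacobi_weight (kappa : nat) : {poly R} := ('X * (1 - 'X)) ^+ kappa.

Lemma pochhammerS (a : R) j : pochhammer a j.+1 = pochhammer a j * (a + j%:R).
Proof. by rewrite /pochhammer big_ord_recr. Qed.

Lemma pochhammerSl (a : R) j : pochhammer a j.+1 = a * pochhammer (a + 1) j.
Proof.
rewrite /pochhammer big_ord_recl addr0; congr (_ * _).
by apply: eq_bigr => i _; rewrite -addrA -[in RHS](natrD _ 1 i) add1n.
Qed.

Lemma pochhammer_gt0 (a : R) j : 0 < a -> 0 < pochhammer a j.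
Proof. by move=> a0; apply: prodr_gt0 => i _; rewrite ltr_wpDr. Qed.

Lemma pochhammerN_eq0 n j : (n < j)%N -> pochhammer (- n%:R) j = 0 :> R.
Proof.
move=> nj; rewrite /pochhammer (bigD1 (Ordinal nj)) //=.
by rewrite addNr mul0r.
Qed.

Lemma fact_natr_neq0 n : n`!%:R != 0 :> R.
Proof. by rewrite pnatr_eq0 -lt0n fact_gt0. Qed.

Lemma coef_gegen_poly kappa n j : (gegen_poly kappa n)`_j = gegen_coef kappa n j.
Proof.
rewrite coef_poly; case: ifPn => //; rewrite -leqNgt => nj.
by rewrite /gegen_coef pochhammerN_eq0 ?mul0r.
Qed.

Lemma gegen_coefS kappa n j :
  gegen_coef kappa n j.+1 * (j.+1%:R * (kappa + j.+1)%:R) =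
  gegen_coef kappa n j * ((j%:R - n%:R) * (n + 2 * kappa + 1 + j)%:R).
Proof.
have p0 : pochhammer kappa.+1%:R j != 0 :> R.
  by rewrite gt_eqF// pochhammer_gt0// ltr0Sn.
have k0 : (kappa + j.+1)%:R != 0 :> R by rewrite pnatr_eq0 addnS.
have j0 : j.+1%:R != 0 :> R by rewrite pnatr_eq0.
rewrite /gegen_coef !pochhammerS factS natrM.
have -> : kappa.+1%:R + j%:R = (kappa + j.+1)%:R :> R by rewrite -natrD addSnnS.
rewrite -natrD; move: p0 k0 j0 (fact_natr_neq0 j).
move: (pochhammer _ _) (_ + _.+1)%:R j.+1%:R (j`!%:R) => p k j1 f p0 k0 j0 f0.
by field; rewrite p0 k0 j0 f0.
Qed.

Lemma gegen_poly_at0 kappa n : (gegen_poly kappa n).[0] = 1.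
Proof.
rewrite horner_coef0 coef_gegen_poly /gegen_coef /pochhammer !big_ord0.
by rewrite fact0 !mulr1 divr1.
Qed.

(** Coefficientwise, Gegenbauer's differential equation is the two-term recurrence
    [gegen_coefS]. *)
Lemma gegen_poly_ode kappa n (F := gegen_poly kappa n) :
  'X * (1 - 'X) * F^`()^`() + kappa.+1%:R * (1 - 'X *+ 2) * F^`()
  = - (gegen_eigen kappa n)%:P * F.
Proof.
have -> : 'X * (1 - 'X) * F^`()^`() + kappa.+1%:R * (1 - 'X *+ 2) * F^`() =
    'X * F^`()^`() - 'X * ('X * F^`()^`())
    + kappa.+1%:R *: F^`() - (2 * kappa.+1%:R) *: ('X * F^`()).
  by rewrite -!mul_polyC polyCM !polyC_natr; ring.
apply/polyP => j.
rewrite !(coefD, coefN, coefZ, coefXM) -polyCN coefCM !coef_deriv.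
have := gegen_coefS kappa n j; rewrite -!coef_gegen_poly -/F /gegen_eigen.
case: j => [|[|j]] /=.
- move: F`_1 F`_0 => a b e.
  transitivity (a * (1 * (kappa + 1)%:R)); first by rewrite natrD -natr1; ring.
  by rewrite e !(natrM, natrD); ring.
- move: F`_2 F`_1 => a b e.
  transitivity (a * (2 * (kappa + 2)%:R) - 2 * kappa.+1%:R * b).
    by rewrite !natrD -natr1; ring.
  by rewrite e !(natrM, natrD) -natr1; ring.
- move: F`_j.+3 F`_j.+2 => a b e.
  transitivity (a * (j.+3%:R * (kappa + j.+3)%:R)
      - b * (j.+2%:R * j.+1%:R + 2 * kappa.+1%:R * j.+2%:R)).
    by rewrite natrD -!natr1; ring.
  by rewrite e !(natrM, natrD) -!natr1; ring.
Qed.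

Lemma deriv_jacobi_weight kappa :
  (jacobi_weight kappa.+1)^`() =
  kappa.+1%:R * (1 - 'X *+ 2) * jacobi_weight kappa.
Proof.
rewrite deriv_exp derivM derivB derivC derivX -/(jacobi_weight kappa) /=.
by rewrite -mulr_natl; ring.
Qed.

Lemma gegen_poly_self_adjoint kappa n (F := gegen_poly kappa n) :
  (jacobi_weight kappa.+1 * F^`())^`() =
  - (gegen_eigen kappa n)%:P * (jacobi_weight kappa * F).
Proof.
rewrite derivM deriv_jacobi_weight /jacobi_weight exprS -/(jacobi_weight kappa).
rewrite mulrCA -gegen_poly_ode -/F; ring.
Qed.

(** Differentiation lowers the degree by one and raises the dimension by two. *)
Lemma deriv_gegen_poly kappa n :
  (gegen_poly kappa n.+1)^`() =
  (- (gegen_eigen kappa n.+1 / kappa.+1%:R)) *: gegen_poly kappa.+1 n.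
Proof.
apply/polyP => j; rewrite coef_deriv coefZ !coef_gegen_poly /gegen_coef.
rewrite -[_ *+ j.+1]mulr_natr !pochhammerSl /gegen_eigen factS natrM.
have -> : - n.+1%:R + 1 = - n%:R :> R by rewrite -natr1; ring.
rewrite !natr1.
have -> : (n.+1 + 2 * kappa + 1).+1 = (n + 2 * kappa.+1 + 1)%N by lia.
have p0 : pochhammer kappa.+2%:R j != 0 :> R.
  by rewrite gt_eqF// pochhammer_gt0// ltr0Sn.
have k0 : kappa.+1%:R != 0 :> R by rewrite pnatr_eq0.
have j0 : j.+1%:R != 0 :> R by rewrite pnatr_eq0.
rewrite natrM; move: p0 k0 j0 (fact_natr_neq0 j).
move: (pochhammer kappa.+2%:R _) (kappa.+1%:R) (j.+1%:R) (j`!%:R).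
by move=> p k j1 f p0 k0 j0 f0; field; rewrite p0 k0 j0 f0.
Qed.

Lemma jacobi_weight_at (kappa : nat) (c : R) : c = 0 \/ c = 1 ->
  (jacobi_weight kappa.+1).[c] = 0.
Proof.
by rewrite /jacobi_weight => -[] ->; rewrite !hornerE ?subrr ?mulr0 expr0n.
Qed.

Lemma polyint_deriv_weighted kappa (p : {poly R}) :
  polyint (jacobi_weight kappa.+1 * p)^`() = 0.
Proof.
by rewrite polyint_deriv !hornerM !jacobi_weight_at ?mul0r ?subrr; auto.
Qed.

Lemma polyint_jacobi_weight kappa :
  polyint (jacobi_weight kappa) = (kappa`! * kappa`!)%:R / (kappa + kappa).+1`!%:R :> R.
Proof. by rewrite /jacobi_weight exprMn polyint_beta. Qed.

(** Integrate (p F' F)' = - lambda w F^2 + p F'^2, where p is the weight of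
    order [kappa + 1], and use [deriv_gegen_poly]. *)
Lemma polyint_gegen_norm kappa n :
  polyint (jacobi_weight kappa * gegen_poly kappa n.+1 ^+ 2) =
  gegen_eigen kappa n.+1 / kappa.+1%:R ^+ 2 *
  polyint (jacobi_weight kappa.+1 * gegen_poly kappa.+1 n ^+ 2).
Proof.
set F := gegen_poly kappa n.+1; set w := jacobi_weight.
set lam := gegen_eigen kappa n.+1.
have lam0 : lam != 0 by rewrite pnatr_eq0.
have k0 : kappa.+1%:R != 0 :> R by rewrite pnatr_eq0.
have := polyint_deriv_weighted kappa (F^`() * F).
have -> : (w kappa.+1 * (F^`() * F))^`() =
    (- lam) *: (w kappa * F ^+ 2) + w kappa.+1 * F^`() ^+ 2.
  rewrite mulrA derivM gegen_poly_self_adjoint -mul_polyC polyCN -/lam -/w -/F.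
  by ring.
rewrite deriv_gegen_poly -/lam exprZn linearP /= -scalerAr linearZ /= => /eqP.
rewrite -/w; move: (polyint _) (polyint _) => a b.
rewrite mulNr addrC subr_eq0 => /eqP e.
by apply: (mulfI lam0); rewrite -e; field.
Qed.

(** The closed form also covers n = 0, where the subtracted binomial is absent. *)
Lemma dim_harmonicsE kappa n :
  dim_harmonics R (2 * kappa + 3) n =
  ((2 * n + 2 * kappa + 1) * (n + 2 * kappa)`!)%:R / (n`! * (2 * kappa + 1)`!)%:R.
Proof.
apply: (mulIf (x := (n`! * (2 * kappa + 1)`!)%:R)).
  by rewrite natrM mulf_neq0 ?fact_natr_neq0.
rewrite divfK ?natrM ?mulf_neq0 ?fact_natr_neq0// -natrM -natrM /dim_harmonics.
have fS : (2 * kappa + 1)`! = ((2 * kappa + 1) * (2 * kappa)`!)%N.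
  by rewrite addn1 factS.
case: n => [|[|m]].
- rewrite /= subr0 bin0 mul1r; congr (_%:R).
  by rewrite fact0 mul1n fS muln0 !add0n.
- rewrite /= subr0 -natrM; congr (_%:R).
  have -> : (1 + (2 * kappa + 3) - 1 = 2 * kappa + 3)%N by lia.
  have -> : (1 + 2 * kappa)`! = (2 * kappa + 1)`! by rewrite addnC.
  by rewrite bin1 mul1n; congr (_ * _)%N; lia.
- rewrite [(2 <= _)%N]/=.
  have -> : (m.+2 + (2 * kappa + 3) - 1 = m.+2 + (2 * kappa + 2))%N by lia.
  have -> : (m.+2 + (2 * kappa + 3) - 3 = m + (2 * kappa + 2))%N by lia.
  have -> : (m.+2 - 2 = m)%N by lia.
  have := bin_fact (leq_addr (2 * kappa + 2) m.+2).
  have := bin_fact (leq_addr (2 * kappa + 2) m).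
  rewrite !addKn; move: 'C(_, _) 'C(_, _) => x y ex ey.
  rewrite mulrBl -!natrM; apply/eqP; rewrite subr_eq -natrD eqr_nat; apply/eqP.
  have KE : (2 * m.+2 + 2 * kappa + 1 = 2 * m + 2 * kappa + 5)%N by lia.
  rewrite KE; move: (2 * m + _ + _)%N KE => K KE.
  move: ex ey; rewrite (_ : (m.+2 + 2 * kappa) = m + (2 * kappa + 2))%N; last lia.
  rewrite !addSn (factS (_ + _).+1) (factS (_ + _)) (factS m.+1) (factS m).
  have -> : ((2 * kappa + 2)`! = (2 * kappa + 2) * (2 * kappa + 1)`!)%N.
    by rewrite [in LHS]addn2 factS addn1 addn2.
  move: (m`!) ((2 * kappa + 1)`!) ((m + _)`!) => f q P ey ex.
  have c0 : (0 < 2 * kappa + 2)%N by rewrite addn2.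
  apply/eqP; rewrite -(eqn_pmul2l c0); apply/eqP.
  have := congr1 (muln (m.+2 * m.+1)) ey; move: ex KE; nia.
Qed.

End GegenbauerPolynomial.

Section GegenbauerNorm.
Context {R : realType}.

Lemma dim_harmonics_rec kappa n :
  dim_harmonics R (2 * kappa + 3) n.+1 * gegen_eigen kappa n.+1 =
  (2 * kappa.+1 * (2 * kappa + 3))%:R * dim_harmonics R (2 * kappa.+1 + 3) n.
Proof.
rewrite !dim_harmonicsE /gegen_eigen.
have e1 : (n.+1 + 2 * kappa + 1 = n + 2 * kappa.+1)%N by lia.
have e2 : ((n + 2 * kappa.+1)`! = (n + 2 * kappa.+1) * (n.+1 + 2 * kappa)`!)%N.
  by rewrite (_ : (n + 2 * kappa.+1 = (n.+1 + 2 * kappa).+1)%N) ?factS//; lia.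
have e3 : ((2 * kappa.+1 + 1)`! =
    (2 * kappa + 3) * ((2 * kappa.+1) * (2 * kappa + 1)`!))%N.
  rewrite (_ : (2 * kappa.+1 + 1 = (2 * kappa + 1).+2)%N); last lia.
  by rewrite !factS; congr (_ * (_ * _))%N; lia.
have e4 : (2 * n.+1 + 2 * kappa + 1 = 2 * n + 2 * kappa.+1 + 1)%N by lia.
rewrite e1 e2 e3 e4 (factS n).
have d0 := @fact_natr_neq0 R n; have f0 := @fact_natr_neq0 R (2 * kappa + 1).
move: (n`!) ((2 * kappa + 1)`!) ((n.+1 + _)`!) d0 f0 => d f z d0 f0.
rewrite !natrM.
have a0 : (2 * kappa + 3)%:R != 0 :> R by rewrite pnatr_eq0 addn3.
have b0 : kappa.+1%:R != 0 :> R by rewrite pnatr_eq0.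
have c0 : n.+1%:R != 0 :> R by rewrite pnatr_eq0.
move: (2 * kappa + 3)%:R kappa.+1%:R n.+1%:R d%:R f%:R z%:R
  (2 * n + _ + _)%:R (n + _)%:R a0 b0 c0 d0 f0.
move=> a b c {}d {}f {}z x y a0 b0 c0 d0 f0.
by field; rewrite a0 b0 c0 d0 f0.
Qed.

Lemma polyint_jacobi_weightS kappa :
  (2 * (2 * kappa + 3))%:R * polyint (jacobi_weight kappa.+1 : {poly R}) =
  kappa.+1%:R * polyint (jacobi_weight kappa : {poly R}).
Proof.
rewrite !polyint_jacobi_weight.
have -> : ((kappa.+1 + kappa.+1).+1`! =
    (2 * kappa + 3) * ((2 * kappa.+1) * (kappa + kappa).+1`!))%N.
  rewrite (_ : ((kappa.+1 + kappa.+1).+1 = (kappa + kappa).+3)%N); last lia.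
  by rewrite [LHS]factS (factS (kappa + kappa).+1); congr (_ * (_ * _))%N; lia.
rewrite (factS kappa).
have f0 := @fact_natr_neq0 R (kappa + kappa).+1.
move: ((kappa + kappa).+1`!) (kappa`!) f0 => f g f0; rewrite !natrM.
have a0 : (2 * kappa + 3)%:R != 0 :> R by rewrite pnatr_eq0 addn3.
have b0 : kappa.+1%:R != 0 :> R by rewrite pnatr_eq0.
move: (2 * kappa + 3)%:R kappa.+1%:R f%:R g%:R a0 b0 f0.
by move=> a b {}f {}g a0 b0 f0; field; rewrite a0 b0 f0.
Qed.

Lemma gegen_poly0 kappa : gegen_poly kappa 0 = 1 :> {poly R}.
Proof.
apply/polyP => -[|j]; rewrite coefC /=.
  by rewrite -horner_coef0 gegen_poly_at0.
by rewrite coef_poly.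
Qed.

(** The derivative maps degree [n + 1] and order [kappa] to degree [n] and order
    [kappa + 1], so the norm is computed by descent on the degree. *)
Lemma dim_harmonics_norm kappa n :
  dim_harmonics R (2 * kappa + 3) n *
    polyint (jacobi_weight kappa * gegen_poly kappa n ^+ 2) =
  polyint (jacobi_weight kappa).
Proof.
elim: n kappa => [|n IH] kappa.
  by rewrite gegen_poly0 expr1n mulr1 /dim_harmonics /= subr0 bin0 mul1r.
rewrite polyint_gegen_norm.
have k0 : kappa.+1%:R != 0 :> R by rewrite pnatr_eq0.
have := dim_harmonics_rec kappa n; have := IH kappa.+1.
have := polyint_jacobi_weightS kappa.
rewrite (_ : 2 * kappa.+1 * (2 * kappa + 3) =
  kappa.+1 * (2 * (2 * kappa + 3)))%N; last lia.
rewrite (natrM _ kappa.+1).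
move: (polyint (_ * _)) (dim_harmonics _ _ n) (dim_harmonics _ _ n.+1) (gegen_eigen _ _).
move: (polyint (jacobi_weight kappa)) (polyint _) (2 * _)%:R kappa.+1%:R k0.
move=> J J1 a b b0 N d d1 lam e1 e2 e3.
have -> : d1 * (lam / b ^+ 2 * N) = (d1 * lam) * (N / b ^+ 2) by ring.
rewrite e3; have -> : b * a * d * (N / b ^+ 2) = a * (d * N) / b by field.
by rewrite e2 e1; field.
Qed.

Lemma polyint_jacobi_weight_gt0 kappa : 0 < polyint (jacobi_weight kappa : {poly R}).
Proof.
by rewrite polyint_jacobi_weight divr_gt0// ltr0n ?muln_gt0 ?fact_gt0.
Qed.

Lemma polyint_gegen_eq0 kappa n :
  polyint (jacobi_weight kappa * gegen_poly kappa n.+1) = 0 :> R.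
Proof.
have := @polyint_deriv_weighted R kappa (gegen_poly kappa n.+1)^`().
rewrite gegen_poly_self_adjoint -polyCN mul_polyC linearZ /= => /eqP.
rewrite mulf_eq0 oppr_eq0 /gegen_eigen pnatr_eq0 muln_eq0 addnC.
by move/eqP.
Qed.

End GegenbauerNorm.

(** * The differential equation of the spline *)

Section SplinePolynomials.
Context {R : realType}.

(** The non-logarithmic part of the spline, multiplied by ((1 - x)/2)^kappa and
    written in the variable (1 - x)/2. *)
Definition spline_poly (kappa : nat) (D : R) : {poly R} :=
  \sum_(1 <= nu < kappa.+1) (spline_coef R kappa nu / 2 ^+ nu) *: 'X^(kappa - nu)
  - D *: 'X^kappa.

Definition flux_coef (kappa j : nat) : R :=
  (kappa`! * (kappa + j)`!)%:R / (j`! * (2 * kappa + 1)`!)%:R.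

(** This is - s^(kappa + 1) k'(s) for the spline k in the variable s, as
    [flux_polyE] shows; unlike those of k, its coefficients follow a single rule. *)
Definition flux_poly (kappa : nat) : {poly R} :=
  \poly_(j < kappa.+1) flux_coef kappa j.

(** The product nu (nu - 1)! = nu! merges the two cases in the definition of g_nu
    into one expression. *)
Lemma spline_coef_flux kappa nu : (0 < nu <= kappa)%N ->
  nu%:R * (spline_coef R kappa nu / 2 ^+ nu) = flux_coef kappa (kappa - nu).
Proof.
move=> /andP[nu0 nuk]; rewrite /spline_coef /flux_coef.
have -> : (kappa + (kappa - nu) = 2 * kappa - nu)%N by lia.
have p2 : 2 ^+ nu != 0 :> R by rewrite expf_neq0// pnatr_eq0.
have f0 := @fact_natr_neq0 R (kappa - nu).
have g0 := @fact_natr_neq0 R (2 * kappa + 1).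
case: ifPn => [/eqP nu1|_].
  rewrite {}nu1 in nu0 nuk p2 f0 *.
  case: kappa nuk f0 g0 => // k _; rewrite subn1 /= => f0 g0.
  have -> : ((2 * k.+1 + 1)`! =
      (2 * k.+1 + 1) * ((2 * k.+1) * (2 * k.+1 - 1)`!))%N.
    rewrite addn1 factS; congr (_ * _)%N.
    by rewrite (_ : (2 * k.+1 = (2 * k.+1 - 1).+1)%N) ?factS ?subn1//; lia.
  have h0 := @fact_natr_neq0 R (2 * k.+1 - 1).
  have a0 : (2 * k.+1 + 1)%:R != 0 :> R by rewrite pnatr_eq0 addn1.
  have b0 : k.+1%:R != 0 :> R by rewrite pnatr_eq0.
  rewrite (factS k); move: (k`!) ((2 * k.+1 - 1)`!) f0 h0 => f h f0 h0.
  rewrite !natrM; move: (2 * k.+1 + 1)%:R k.+1%:R f%:R h%:R a0 b0 f0 h0.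
  move=> a b {}f {}h a0 b0 f0 h0.
  by field; rewrite a0 b0 f0 h0.
have e : ('C(kappa, nu) * (nu`! * (kappa - nu)`!) = kappa`!)%N by rewrite bin_fact.
have e2 : (nu`! = nu * (nu - 1)`!)%N.
  by case: nu nu0 {nuk p2 f0 e} => // k _; rewrite factS subn1.
rewrite -e e2; move: (_`!) (_`!) (_`!) (_`!) ('C(_, _)) f0 g0 => f g h i c.
rewrite !natrM; move: f%:R g%:R h%:R i%:R c%:R nu%:R (2 ^+ nu) p2.
by move=> a b c' d' e' n' p p0 c0 b0; field; rewrite c0 b0 p0.
Qed.

Lemma flux_coef_last kappa : flux_coef kappa kappa = (2 * kappa + 1)%:R^-1.
Proof.
rewrite /flux_coef addnn -mul2n addn1 factS.
move: (kappa`!) ((2 * kappa)`!) (fact_natr_neq0 (R := R) kappa)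
  (fact_natr_neq0 (R := R) (2 * kappa)) => f g f0 g0.
have a0 : (2 * kappa).+1%:R != 0 :> R by rewrite pnatr_eq0.
rewrite !natrM; move: (2 * kappa).+1%:R f%:R g%:R a0 f0 g0.
by move=> a {}f {}g a0 f0 g0; field; rewrite a0 f0 g0.
Qed.

Lemma flux_polyE kappa D (S := spline_poly kappa D) :
  flux_poly kappa =
  ((2 * kappa + 1)%N)%:R^-1 *: 'X^kappa + kappa%:R *: S - 'X * S^`().
Proof.
have -> : 'X * S^`() =
    \sum_(1 <= nu < kappa.+1)
      ((kappa%:R - nu%:R) * (spline_coef R kappa nu / 2 ^+ nu)) *: 'X^(kappa - nu)
    - (kappa%:R * D) *: 'X^kappa.
  have XdX (m : nat) : 'X * ('X^m)^`() = m%:R *: 'X^m :> {poly R}.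
    rewrite derivXn -scaler_nat -scalerAr; case: m => [|m]; first by rewrite !scale0r.
    by rewrite -exprS.
  rewrite /S /spline_poly derivB derivZ (raddf_sum deriv) mulrBr -scalerAr XdX scalerA (mulrC D).
  congr (_ - _); rewrite mulr_sumr; apply: eq_big_nat => nu /andP[nu0 nuk].
  by rewrite /= derivZ -scalerAr XdX scalerA natrB// mulrC.
rewrite /S /spline_poly scalerBr scalerA.
(* The terms in D cancel. *)
rewrite [RHS](_ : forall a b c d : {poly R}, a + (b - c) - (d - c) = a + (b - d));
  last by move=> a b c d; ring.
rewrite scaler_sumr -sumrB.
have -> : \sum_(1 <= nu < kappa.+1)
    (kappa%:R *: ((spline_coef R kappa nu / 2 ^+ nu) *: 'X^(kappa - nu)) -
    ((kappa%:R - nu%:R) * (spline_coef R kappa nu / 2 ^+ nu)) *: 'X^(kappa - nu))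
  = \sum_(1 <= nu < kappa.+1) flux_coef kappa (kappa - nu) *: 'X^(kappa - nu)
    :> {poly R}.
  apply: eq_big_nat => nu nuk; rewrite scalerA -scalerBl -mulrBl opprB addrC subrK.
  by rewrite spline_coef_flux.
transitivity (\sum_(0 <= nu < kappa.+1)
    flux_coef kappa (kappa - nu) *: 'X^(kappa - nu) : {poly R}); last first.
  by rewrite big_ltn// subn0 flux_coef_last.
rewrite /flux_poly poly_def -(big_mkord xpredT (fun j => flux_coef kappa j *: 'X^j)).
rewrite big_nat_rev /=; apply: eq_big_nat => nu nuk.
by rewrite add0n subSS.
Qed.

(** Multiplied by (1 - s)^kappa, this is (p k')' = w. *)
Lemma flux_poly_ode kappa :
  (flux_poly kappa)^`() * (1 - 'X) - kappa.+1%:R * flux_poly kappa = - 'X^kappa.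
Proof.
have -> : (flux_poly kappa)^`() * (1 - 'X) - kappa.+1%:R * flux_poly kappa =
    (flux_poly kappa)^`() - 'X * (flux_poly kappa)^`() - kappa.+1%:R *: flux_poly kappa.
  by rewrite scaler_nat; ring.
apply/polyP => j; rewrite !(coefD, coefN, coefZ, coefXM) !coef_deriv coefXn !coef_poly.
have -> : (if j == 0%N then 0 else
    (if (j.-1.+1 < kappa.+1)%N then flux_coef kappa j.-1.+1 else 0) *+ j.-1.+1)
  = (if (j < kappa.+1)%N then flux_coef kappa j else 0) *+ j :> R.
  by case: j.
rewrite !ltnS; have [jk|kj|->] := ltngtP j kappa.
- rewrite oppr0; apply/eqP; rewrite subr_eq0 subr_eq; apply/eqP.
  have -> : flux_coef kappa j.+1 = flux_coef kappa j * (kappa + j).+1%:R / j.+1%:R.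
    rewrite /flux_coef addnS factS (factS j).
    have f0 := @fact_natr_neq0 R j; have g0 := @fact_natr_neq0 R (2 * kappa + 1).
    move: (kappa`!) (j`!) ((2 * kappa + 1)`!) ((kappa + j)`!) f0 g0 => f g h i f0 g0.
    have a0 : j.+1%:R != 0 :> R by rewrite pnatr_eq0.
    rewrite !natrM; move: j.+1%:R f%:R g%:R h%:R i%:R a0 f0 g0.
    by move=> a {}f {}g {}h {}i a0 f0 g0; field; rewrite a0 f0 g0.
  rewrite -[_ *+ j.+1]mulr_natr divfK ?pnatr_eq0//.
  by rewrite -[_ *+ j]mulr_natr -addSn natrD; ring.
- by rewrite !mul0rn mulr0 !subr0 oppr0.
- rewrite flux_coef_last.
  have a0 : (2 * kappa + 1)%:R != 0 :> R by rewrite pnatr_eq0 addn1.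
  apply: (mulIf a0); rewrite mulN1r -[_ *+ kappa]mulr_natr mul0rn sub0r.
  rewrite mulrBl mulNr mulrAC mulVf// mul1r -mulrA mulVf// mulr1.
  by rewrite natrD natrM -natr1; ring.
Qed.

End SplinePolynomials.

(** * The moments of the spline *)

Section SplineMoments.
Context {R : realType}.

(** The antiderivative of [w F + lambda k w F] is [p (k' F - k F')], with
    [p = s^(kappa+1) (1-s)^(kappa+1)]; its logarithmic part is handled by
    [polylnint_deriv] and its polynomial part is the polynomial [U] below. *)
Lemma spline_moment kappa D n (S := spline_poly kappa D) (F := gegen_poly kappa n.+1) :
  gegen_eigen kappa n.+1 *
    (polyint (S * (1 - 'X) ^+ kappa * F)
     - ((2 * kappa + 1)%N)%:R^-1 * polylnint (jacobi_weight kappa * F))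
  = polyint (jacobi_weight kappa) :> R.
Proof.
set lam := gegen_eigen _ _; set c := _^-1; set V := flux_poly kappa : {poly R}.
have dG m : ((1 - 'X : {poly R}) ^+ m.+1)^`() = - (m.+1%:R * (1 - 'X) ^+ m).
  by rewrite deriv_exp derivB derivC derivX /= -mulr_natl; ring.
have VE : V = c%:P * 'X^kappa + kappa%:R * S - 'X * S^`().
  by rewrite /V (flux_polyE kappa D) mul_polyC scaler_nat mulr_natl.
have dV : V^`() * (1 - 'X) = kappa.+1%:R * V - 'X^kappa.
  by rewrite -(flux_poly_ode kappa) -/V; ring.
have dQ : ((1 - 'X) ^+ kappa.+1 * V)^`() = - jacobi_weight kappa.
  rewrite derivM dG /jacobi_weight exprMn exprS.
  rewrite (_ : _ * V^`() = (1 - 'X) ^+ kappa * (V^`() * (1 - 'X))); last by ring.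
  by rewrite dV; ring.
have V0 : V.[0] = polyint (jacobi_weight kappa).
  have : polyint ((1 - 'X) ^+ kappa.+1 * V)^`() = - V.[0].
    rewrite polyint_deriv !hornerE subrr expr0n /= !mul0r subr0 expr1n mul1r.
    by rewrite sub0r.
  by rewrite dQ linearN => /oppr_inj.
have ode := gegen_poly_ode kappa n.+1; rewrite -/F -/lam in ode.
have LE : lam * polylnint (jacobi_weight kappa * F) =
    polyint ('X^kappa * (1 - 'X) ^+ kappa.+1 * F^`()).
  apply: oppr_inj; rewrite -polylnint_deriv -mulNr.
  have -> : 'X * ('X^kappa * (1 - 'X) ^+ kappa.+1 * F^`()) =
      jacobi_weight kappa.+1 * F^`().
    by rewrite /jacobi_weight exprMn !exprS; ring.
  by rewrite gegen_poly_self_adjoint -/F -/lam -polyCN mul_polyC linearZ.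
pose U := - ((1 - 'X) ^+ kappa.+1 * V * F) - 'X * (1 - 'X) ^+ kappa.+1 * S * F^`().
have dU : U^`() = jacobi_weight kappa * F
    - c *: ('X^kappa * (1 - 'X) ^+ kappa.+1 * F^`())
    + lam *: (S * (1 - 'X) ^+ kappa * F).
  have d1 : ((1 - 'X) ^+ kappa.+1 * V * F)^`() =
      - jacobi_weight kappa * F + (1 - 'X) ^+ kappa.+1 * V * F^`().
    by rewrite derivM dQ.
  have d2 : ('X * (1 - 'X) ^+ kappa.+1 * S * F^`())^`() =
      ((1 - 'X) ^+ kappa.+1 - 'X * (kappa.+1%:R * (1 - 'X) ^+ kappa)) * S * F^`()
      + 'X * (1 - 'X) ^+ kappa.+1 * (S^`() * F^`() + S * F^`()^`()).
    by rewrite derivM (derivM _ S) (derivM 'X) dG derivX; ring.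
  rewrite /U derivB derivN d1 d2.
  rewrite -!mul_polyC /jacobi_weight exprMn exprS.
  have -> : 'X * ((1 - 'X) * (1 - 'X) ^+ kappa) * (S^`() * F^`() + S * F^`()^`()) =
      'X * ((1 - 'X) * (1 - 'X) ^+ kappa) * S^`() * F^`()
      + (1 - 'X) ^+ kappa * S * ('X * (1 - 'X) * F^`()^`()) by ring.
  have -> : 'X * (1 - 'X) * F^`()^`() =
      - lam%:P * F - kappa.+1%:R * (1 - 'X *+ 2) * F^`().
    by rewrite -ode; ring.
  by rewrite VE -natr1; ring.
have : polyint U^`() = polyint (jacobi_weight kappa).
  rewrite polyint_deriv -V0 /U !hornerE gegen_poly_at0 subrr expr0n /=.
  by rewrite !(mul0r, subr0) expr1n; ring.
have J0 : polyint (jacobi_weight kappa * F) = 0 by exact: polyint_gegen_eq0.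
have -> : polyint U^`() = - (c * polyint ('X^kappa * (1 - 'X) ^+ kappa.+1 * F^`()))
    + lam * polyint (S * (1 - 'X) ^+ kappa * F).
  by rewrite dU linearD /= raddfB /= !linearZ /= J0; ring.
by rewrite -LE => <-; ring.
Qed.

Lemma polylnint_jacobi_weight kappa :
  polylnint (jacobi_weight kappa) = - ((-1) ^+ kappa *
    \sum_(0 <= nu < kappa.+1)
      'C(kappa, nu)%:R * ((-1) ^+ nu / ((2 * kappa - nu + 1)%N)%:R ^+ 2)) :> R.
Proof.
have -> : jacobi_weight kappa = \sum_(0 <= nu < kappa.+1)
    ((-1) ^+ (kappa - nu) * 'C(kappa, nu)%:R) *: 'X^(2 * kappa - nu) :> {poly R}.
  rewrite /jacobi_weight exprMn [1 - 'X]addrC exprDn mulr_sumr big_mkord.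
  apply: eq_bigr => i _; rewrite expr1n mulr1 (exprNn 'X) mulrnAr.
  have ik : (i <= kappa)%N by rewrite -ltnS.
  rewrite mulrCA -exprD (_ : (kappa + (kappa - i) = 2 * kappa - i)%N); last lia.
  rewrite -mul_polyC polyCM polyC_natr polyC_exp polyCN -mulr_natr; ring.
rewrite linear_sum mulr_sumr -sumrN; apply: eq_big_nat => nu nuk.
rewrite linearZ /= polylnintXn addn1.
have -> : (-1) ^+ kappa = (-1) ^+ (kappa - nu) * (-1) ^+ nu :> R.
  by rewrite -exprD subnK.
have := sqrr_sign R nu; rewrite expr2.
move: ((-1 : R) ^+ nu) ((-1 : R) ^+ _) => x y xx.
rewrite -[in LHS](mulr1 (_ * _)) -xx -[_ ^- 2]exprVn exprVn.
by move: (_ ^+ 2) => z; ring.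
Qed.

(** The quantity whose quotient by f_kappa defines D_lambda is the weighted
    integral of the spline without its constant. *)
Lemma spline_const_numerator kappa :
  \sum_(1 <= nu < kappa.+1) spline_coef R kappa nu * spline_G1 R kappa nu
   + ((2 * kappa + 1)%N)%:R^-1 * 2 ^+ (2 * kappa + 1) * (-1) ^+ kappa *
     \sum_(0 <= nu < kappa.+1)
        'C(kappa, nu)%:R * ((-1) ^+ nu / ((2 * kappa - nu + 1)%N)%:R ^+ 2)
  = 2 ^+ (2 * kappa + 1) *
    (polyint (spline_poly kappa 0 * (1 - 'X) ^+ kappa)
     - ((2 * kappa + 1)%N)%:R^-1 * polylnint (jacobi_weight kappa)) :> R.
Proof.
rewrite mulrBr; congr (_ + _).
  rewrite /spline_poly scale0r subr0 mulr_suml linear_sum mulr_sumr.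
  apply: eq_big_nat => nu /andP[nu0 nuk].
  rewrite -scalerAl linearZ /= polyint_beta /spline_G1 /=.
  have -> : (2 * kappa - nu + 1 = (kappa - nu + kappa).+1)%N by lia.
  have -> : 2 ^+ (2 * kappa + 1) = 2 ^+ (kappa - nu + kappa).+1 * 2 ^+ nu :> R.
    by rewrite -exprD; congr (_ ^+ _); lia.
  have p2 : 2 ^+ nu != 0 :> R by rewrite expf_neq0// pnatr_eq0.
  have f0 := @fact_natr_neq0 R (kappa - nu + kappa).+1.
  rewrite [(kappa`! * _)%N]mulnC.
  move: (_ * _)%:R (_ .+1`!)%:R ((2 : R) ^+ nu) ((2 : R) ^+ _) p2 f0 => x y z t z0 y0.
  by field; rewrite z0 y0.
by rewrite polylnint_jacobi_weight; ring.
Qed.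

End SplineMoments.

(** * From the hypergeometric series to polynomials *)

Section GegenbauerSeries.
Context {R : realType}.

Lemma sphere_orderE kappa : sphere_order R (2 * kappa + 3) = kappa%:R + 1 / 2.
Proof. by rewrite /sphere_order natrD natrM; field. Qed.

Lemma gegenbauerE kappa n (x : R) :
  gegenbauer (sphere_order R (2 * kappa + 3)) n x =
  (gegen_poly kappa n).[(1 - x) / 2].
Proof.
rewrite /gegenbauer sphere_orderE /hyp2F1; set z := (1 - x) / 2.
have -> : n%:R + 2 * (kappa%:R + 1 / 2) = (n + 2 * kappa + 1)%:R :> R.
  by rewrite natrD natrD natrM; field.
have -> : kappa%:R + 1 / 2 + 1 / 2 = kappa.+1%:R :> R by rewrite -natr1; field.
(* The hypergeometric series terminates. *)
apply/cvg_lim => //; apply: cvg_near_cst; exists n.+1 => //= m /= nm.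
rewrite /series /= big_mkord (@horner_coef_wide _ m); last first.
  by rewrite (leq_trans (size_poly _ _)).
by apply: eq_bigr => i _; rewrite coef_gegen_poly.
Qed.

Lemma gegenbauer_weightE kappa (x : R) : -1 <= x <= 1 ->
  gegenbauer_weight (sphere_order R (2 * kappa + 3)) x =
  4 ^+ kappa * (jacobi_weight kappa).[(1 - x) / 2].
Proof.
move=> x1; rewrite /gegenbauer_weight sphere_orderE addrK powR_mulrn; last nra.
by rewrite /jacobi_weight !hornerE -exprMn; congr (_ ^+ _); field.
Qed.

Lemma weight_mass_poly kappa :
  weight_mass (sphere_order R (2 * kappa + 3) - 1 / 2) =
  2 ^+ (2 * kappa + 1) * polyint (jacobi_weight kappa : {poly R}).
Proof.
have [_ e] := integral_poly_ln (4 ^+ kappa *: jacobi_weight kappa : {poly R}) 0.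
rewrite linear0 addr0 linearZ /= in e.
rewrite /weight_mass addn1 exprS exprM -natrX -mulrA -e; apply: eq_Rintegral => x.
rewrite inE /= in_itv /= => x1.
have := gegenbauer_weightE kappa x1; rewrite /gegenbauer_weight => ->.
by rewrite horner0 mul0r addr0 hornerZ.
Qed.

Lemma spline_constE kappa :
  spline_const R kappa * polyint (jacobi_weight kappa) =
  polyint (spline_poly kappa 0 * (1 - 'X) ^+ kappa)
  - ((2 * kappa + 1)%N)%:R^-1 * polylnint (jacobi_weight kappa).
Proof.
rewrite /spline_const spline_const_numerator weight_mass_poly.
have w0 : polyint (jacobi_weight kappa) != 0 :> R.
  by rewrite gt_eqF// polyint_jacobi_weight_gt0.
have p0 : 2 ^+ (2 * kappa + 1) != 0 :> R by rewrite expf_neq0// pnatr_eq0.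
by move: (_ - _) => z; field; rewrite w0 p0.
Qed.

Lemma spline_mean kappa (D := spline_const R kappa) :
  polyint (spline_poly kappa D * (1 - 'X) ^+ kappa)
  - ((2 * kappa + 1)%N)%:R^-1 * polylnint (jacobi_weight kappa) = 0.
Proof.
have -> : spline_poly kappa D = spline_poly kappa 0 - D *: 'X^kappa.
  by rewrite /spline_poly scale0r subr0.
rewrite mulrBl -scalerAl -exprMn -/(jacobi_weight kappa) raddfB /= linearZ /=.
by rewrite spline_constE; ring.
Qed.

End GegenbauerSeries.

(** * The closed formula has the required expansion *)

Section SplineExpansion.
Context {R : realType}.
Notation mu := (@lebesgue_measure R).

(** The value of [h] at 1 is arbitrary. *)
Lemma integral_eq_poly_ln (h : R -> R) (A B : {poly R}) :
  (forall x, -1 <= x < 1 ->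
     h x = A.[(1 - x) / 2] + B.[(1 - x) / 2] * ln ((1 - x) / 2)) ->
  mu.-integrable `[-1, 1] (EFin \o h) /\
  \int[mu]_(x in `[-1, 1]) h x = 2 * (polyint A + polylnint B).
Proof.
move=> hE; pose g (x : R) := A.[(1 - x) / 2] + B.[(1 - x) / 2] * ln ((1 - x) / 2).
have [gi ge] := integral_poly_ln A B; rewrite -/g in gi ge.
have gh : {in `]-1, 1[%R, g =1 h}.
  by move=> x; rewrite in_itv/= => /andP[/ltW x1 x2]; rewrite hE// x1.
have mg : measurable_fun (`]-1, 1[%classic : set R) g.
  apply: measurable_funS (measurable_itv _) _ _ => //.
    exact: subset_itv_oo_cc.
  by move/measurable_int : gi => /measurable_EFinP.
have mh : measurable_fun (`]-1, 1[%classic : set R) h.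
  by apply: eq_measurable_fun mg => x; rewrite inE => /gh.
have mh' : measurable_fun (`[-1, 1]%classic : set R) (EFin \o h).
  by apply/emeasurable_fun_itv_bndo_bndcP/emeasurable_fun_itv_obnd_cbndP/measurable_EFinP.
split.
  apply/integrableP; split => //.
  case/integrableP : gi => _; congr (_ < _)%E.
  apply: (@eq_integral_itv_bounded _ _ _ (Num.norm \o h) (Num.norm \o g)) => //.
  - exact: measurableT_comp.
  - exact: measurableT_comp.
  - by move=> x /gh /= ->.
rewrite -ge /Rintegral; congr fine.
by apply: eq_integral_itv_bounded => // x /gh.
Qed.

Section Spline.
Variable kappa : nat.
Let lambda : R := sphere_order R (2 * kappa + 3).
Let c : R := ((2 * kappa + 1)%N)%:R^-1.
Let D : R := spline_const R kappa.

Definition spline_fun (x : R) : R :=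
  -1 / ((2 * kappa + 1)%N)%:R * ln ((1 - x) / 2)
  + \sum_(1 <= nu < kappa.+1) spline_coef R kappa nu * (1 - x) ^- nu
  - spline_const R kappa.

Lemma spline_funE (x : R) (s := (1 - x) / 2) : x != 1 ->
  spline_fun x = - c * ln s + (spline_poly kappa D).[s] / s ^+ kappa.
Proof.
move=> x1; have x0 : 1 - x != 0 by rewrite subr_eq0 eq_sym.
have s0 : s != 0 by rewrite mulf_neq0// invr_eq0 pnatr_eq0.
rewrite /spline_fun mulN1r -/c -addrA; congr (_ + _).
rewrite /spline_poly !hornerE mulrBl mulfK ?expf_neq0//; congr (_ - _).
rewrite horner_sum mulr_suml; apply: eq_big_nat => nu /andP[_ nuk].
rewrite !hornerE -(@subnK nu kappa)// exprD.
have sp : s ^+ (kappa - nu) != 0 by rewrite expf_neq0.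
have -> : 1 - x = s * 2 by rewrite /s divfK ?pnatr_eq0.
rewrite exprMn addnK.
move: (s ^+ nu) (expf_neq0 nu s0) (s ^+ _) sp (2 ^+ nu) (@expf_neq0 R 2 nu).
move=> a a0 b b0 e; rewrite pnatr_eq0 => /(_ isT) e0.
by field; rewrite a0 b0 e0.
Qed.

Lemma spline_fun_weight (x : R) : -1 <= x < 1 ->
  spline_fun x * gegenbauer_weight lambda x =
  4 ^+ kappa * ((spline_poly kappa D * (1 - 'X) ^+ kappa).[(1 - x) / 2]
    - c * (jacobi_weight kappa).[(1 - x) / 2] * ln ((1 - x) / 2)).
Proof.
move=> /andP[x1 x2].
rewrite gegenbauer_weightE; last by rewrite x1 ltW.
rewrite mulrCA; congr (_ * _).
rewrite spline_funE ?lt_eqF//; set s := (1 - x) / 2.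
have s0 : s != 0 by rewrite mulf_neq0 ?invr_eq0 ?pnatr_eq0// subr_eq0 gt_eqF.
have Gs : ((1 - 'X : {poly R}) ^+ kappa).[s] = (1 - s) ^+ kappa.
  by rewrite horner_exp !hornerE.
have ws : (jacobi_weight kappa : {poly R}).[s] = s ^+ kappa * (1 - s) ^+ kappa.
  by rewrite /jacobi_weight horner_exp !hornerE exprMn.
rewrite hornerM Gs ws.
move: (s ^+ kappa) (expf_neq0 kappa s0) ((spline_poly _ _).[s]) => y y0 z.
by move: (_ ^+ kappa) (ln s) => a b; field.
Qed.

Lemma spline_fun_weight_poly (x : R) (p : {poly R}) : -1 <= x < 1 ->
  spline_fun x * p.[(1 - x) / 2] * gegenbauer_weight lambda x =
  (4 ^+ kappa *: (spline_poly kappa D * (1 - 'X) ^+ kappa * p)).[(1 - x) / 2]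
  + (- (c * 4 ^+ kappa) *: (jacobi_weight kappa * p)).[(1 - x) / 2]
    * ln ((1 - x) / 2).
Proof.
move=> x1; rewrite mulrAC spline_fun_weight// !hornerZ !(hornerM _ p).
by move: (_.[_]) (_.[_]) (_.[_]) (ln _) => a b d e; ring.
Qed.

Lemma gegenbauer_dot_spline (k : R -> R) (n : nat) :
  (forall x, -1 <= x < 1 -> k x = spline_fun x) ->
  gegenbauer_dot lambda k (gegenbauer lambda n) =
  2 * 4 ^+ kappa *
    (polyint (spline_poly kappa D * (1 - 'X) ^+ kappa * gegen_poly kappa n)
     - c * polylnint (jacobi_weight kappa * gegen_poly kappa n)).
Proof.
move=> kE; rewrite /gegenbauer_dot.
have [_ ->] := @integral_eq_poly_ln _
  (4 ^+ kappa *: (spline_poly kappa D * (1 - 'X) ^+ kappa * gegen_poly kappa n))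
  (- (c * 4 ^+ kappa) *: (jacobi_weight kappa * gegen_poly kappa n))
  (fun x (x1 : -1 <= x < 1) => etrans (congr1
    (fun y => y * gegenbauer lambda n x * gegenbauer_weight lambda x) (kE x x1))
    (etrans (congr1 (fun y => spline_fun x * y * gegenbauer_weight lambda x)
       (gegenbauerE kappa n x)) (spline_fun_weight_poly _ x1))).
by rewrite polyintZ polylnintZ; ring.
Qed.

Lemma gegenbauer_dot_norm (n : nat) :
  gegenbauer_dot lambda (gegenbauer lambda n) (gegenbauer lambda n) =
  2 * 4 ^+ kappa * polyint (jacobi_weight kappa * gegen_poly kappa n ^+ 2).
Proof.
rewrite /gegenbauer_dot.
have [|_ ->] := @integral_eq_poly_ln
  (fun x => gegenbauer lambda n x * gegenbauer lambda n x * gegenbauer_weight lambda x)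
  (4 ^+ kappa *: (jacobi_weight kappa * gegen_poly kappa n ^+ 2)) 0.
  move=> x /andP[x1 x2]; rewrite gegenbauer_weightE; last by rewrite x1 ltW.
  rewrite gegenbauerE horner0 mul0r addr0 hornerZ hornerM [(gegen_poly _ _ ^+ 2).[_]]horner_exp.
  by move: (_.[_]) (_.[_]) => a b; ring.
by rewrite linear0 addr0 linearZ /= mulrA.
Qed.

Lemma gegenbauer_dot_norm_dim (n : nat) :
  dim_harmonics R (2 * kappa + 3) n *
    gegenbauer_dot lambda (gegenbauer lambda n) (gegenbauer lambda n) =
  2 * 4 ^+ kappa * polyint (jacobi_weight kappa).
Proof.
by rewrite gegenbauer_dot_norm mulrCA dim_harmonics_norm.
Qed.

Lemma gegenbauer_dot_norm_neq0 (n : nat) :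
  gegenbauer_dot lambda (gegenbauer lambda n) (gegenbauer lambda n) != 0.
Proof.
have : 2 * 4 ^+ kappa * polyint (jacobi_weight kappa) != 0 :> R.
  by rewrite !mulf_neq0 ?expf_neq0 ?pnatr_eq0// gt_eqF// polyint_jacobi_weight_gt0.
by rewrite -(gegenbauer_dot_norm_dim n) mulf_eq0 negb_or => /andP[].
Qed.

Lemma thinplate_spline_of_formula (k : R -> R) :
  (forall x, -1 <= x < 1 -> k x = spline_fun x) ->
  is_thinplate_spline (2 * kappa + 3) k.
Proof.
move=> kE; split.
- pose s (x : R) := (1 - x) / 2.
  apply: (@subspace_eq_continuous _ _ _
    (fun x => - c * ln (s x) + (spline_poly kappa D).[s x] / s x ^+ kappa)).
    move=> x; rewrite inE /= in_itv/= => /andP[x1 x2]; apply/esym.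
    rewrite -spline_funE ?lt_eqF//; apply: kE; exact/andP.
  apply: continuous_in_subspaceT => x; rewrite inE /= in_itv/= => /andP[x1 x2].
  have cs : {for x, continuous s}.
    apply: cvgM; last exact: cvg_cst.
    by apply: cvgB; [exact: cvg_cst|exact: cvg_id].
  have s0 : 0 < s x by rewrite divr_gt0// subr_gt0.
  apply: cvgD; last apply: cvgM.
  - apply: cvgM; first exact: cvg_cst.
    by apply: (@continuous_comp _ _ _ s (@ln R)) => //; exact: continuous_ln.
  - apply: (@continuous_comp _ _ _ s (horner (spline_poly kappa D))) => //.
    exact: continuous_horner.
  - apply: cvgV; first by rewrite expf_neq0// gt_eqF.
    apply: (@continuous_comp _ _ _ s (fun y : R => y ^+ kappa)) => //.
    exact: exprn_continuous.
- have [] // := @integral_eq_poly_ln (fun x => k x * gegenbauer_weight lambda x)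
    (4 ^+ kappa *: (spline_poly kappa D * (1 - 'X) ^+ kappa * 1))
    (- (c * 4 ^+ kappa) *: (jacobi_weight kappa * 1)).
  move=> x x1; rewrite kE// -spline_fun_weight_poly//.
  by rewrite hornerC mulr1.
- rewrite (gegenbauer_dot_spline _ kE) gegen_poly0 !mulr1.
  by rewrite spline_mean mulr0.
- move=> [//|n] _.
  apply: (mulIf (gegenbauer_dot_norm_neq0 n.+1)).
  rewrite divfK ?gegenbauer_dot_norm_neq0//.
  rewrite -mulrA gegenbauer_dot_norm_dim (gegenbauer_dot_spline _ kE).
  have l0 : gegen_eigen kappa n.+1 != 0 :> R by rewrite pnatr_eq0.
  have -> : n.+1%:R * (n.+1%:R + (2 * kappa + 3)%:R - 2) = gegen_eigen kappa n.+1 :> R.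
    by rewrite /gegen_eigen natrM natrD natrD natrD natrM; ring.
  apply: (mulfI l0); rewrite mulrCA [in RHS]mulrA divff// mul1r.
  by rewrite spline_moment.
Qed.

End Spline.
End SplineExpansion.

(** * Uniqueness of the spline *)

Section Determinacy.
Context {R : realType}.
Notation mu := (@lebesgue_measure R).
Let I : set (measurableTypeR R) := `[-1, 1]%classic.
Let mI : measurable I. Proof. exact: measurable_itv. Qed.

Lemma bernoulli_inequality (x : R) (n : nat) : 0 <= x -> 1 + n%:R * x <= (1 + x) ^+ n.
Proof.
move=> x0; elim: n => [|n IH]; first by rewrite mul0r addr0 expr0.
rewrite exprS; apply: le_trans (ler_wpM2l (addr_ge0 ler01 x0) IH).
rewrite -natr1 -subr_ge0.
have -> : (1 + x) * (1 + n%:R * x) - (1 + (n%:R + 1) * x) = n%:R * x ^+ 2 by ring.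
by rewrite mulr_ge0// sqr_ge0.
Qed.

Lemma bounded_horner (p : {poly R}) : [bounded p.[x] | x in I].
Proof.
exists (\sum_(i < size p) `|p`_i|); split; first exact: num_real.
move=> M /ltW pM x; rewrite /I /= in_itv/= => x1.
apply: le_trans pM; rewrite horner_coef; apply: le_trans (ler_norm_sum _ _ _) _.
apply: ler_sum => i _; rewrite normrM normrX ler_piMr// exprn_ile1//.
by rewrite ler_norml.
Qed.

Lemma integrable_horner (u : R -> R) (p : {poly R}) :
  mu.-integrable I (EFin \o u) ->
  mu.-integrable I (EFin \o (fun x => u x * p.[x])).
Proof.
move=> ui.
have mp : measurable_fun I (horner p).
  apply: measurable_funTS; apply: continuous_measurable_fun.
  exact: continuous_horner.
exact: (eq_integrable mI _ _ _ (integrableMl mI ui mp (bounded_horner p))).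
Qed.

(** Powers of a polynomial larger than 1 exactly on ]a, b[ concentrate the mass
    of [u] there. *)
Lemma moments_eq0_no_bump (u : R -> R) (a b m : R) :
  mu.-integrable I (EFin \o u) ->
  (forall p : {poly R}, \int[mu]_(x in I) (u x * p.[x]) = 0) ->
  -1 < a -> a < b -> b < 1 -> 0 < m -> (forall x, a <= x <= b -> m <= u x) ->
  False.
Proof.
move=> ui up a1 ab b1 m0 um.
pose c := (a + b) / 2; pose r := (b - a) / 2.
have r0 : 0 < r by rewrite divr_gt0// subr_gt0.
(* [q] is 1 at a and b, at least 1 + eta on the middle half of [a, b], and in
   [0, 1] outside [a, b], since `|x - c| <= 2 on [-1, 1]. *)
pose q : {poly R} := 1 + (r ^+ 2 / 4)%:P - 4^-1 *: ('X - c%:P) ^+ 2.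
have qE x : q.[x] = 1 + (r ^+ 2 - (x - c) ^+ 2) / 4.
  by rewrite /q !(hornerD, hornerN, hornerZ, hornerC) horner_exp hornerXsubC; field.
have aE : a = c - r by rewrite /c /r; field.
have bE : b = c + r by rewrite /c /r; field.
pose eta : R := 3 / 16 * r ^+ 2.
have eta0 : 0 < eta by rewrite mulr_gt0// exprn_gt0.
pose J : set (measurableTypeR R) := `[c - r / 2, c + r / 2]%classic.
have JI : J `<=` I.
  move=> x; rewrite /J /I /= !in_itv/= => /andP[x1 x2]; lra.
have mJ : measurable J by exact: measurable_itv.
have muJ : mu J = r%:E.
  by rewrite lebesgue_measure_itv /= lte_fin ifT -?EFinB; [congr EFin; field|lra].
set K := \int[mu]_(x in I) `|u x|.
(* On [-1, 1], u q^n is at least m (1 + eta)^n on the middle half J of [a, b]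
   and at least - `|u| elsewhere. *)
have bound (n : nat) : m * (1 + eta) ^+ n * r <= K.
  have iI : mu.-integrable I (EFin \o (fun x => m * (1 + eta) ^+ n * \1_J x)).
    apply: (eq_integrable mI _ _ _ (integrableZl mI (m * (1 + eta) ^+ n)
      (integrableS measurableT mI (subsetT _) (integrable_indic_itv _ _ _ _)))).
    by [].
  have ni : mu.-integrable I (EFin \o (fun x => `|u x|)) by exact: integrable_norm.
  have le : \int[mu]_(x in I) (m * (1 + eta) ^+ n * \1_J x - `|u x|) <=
      \int[mu]_(x in I) (u x * (q ^+ n).[x]).
    apply: le_Rintegral => //.
    - exact: (integrableB mI iI ni).
    - exact: integrable_horner.
    move=> x; rewrite /I /= in_itv/= => /andP[x1 x2].
    rewrite horner_exp qE indicE.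
    have q0 : 0 <= 1 + (r ^+ 2 - (x - c) ^+ 2) / 4 by nra.
    have [xab|xab] := boolP (a <= x <= b).
      have u0 : 0 <= u x by apply: le_trans (um x xab); exact: ltW.
      case: (boolP (x \in J)) => [|_]; last first.
        by rewrite mulr0 sub0r; apply: (@le_trans _ _ 0);
          [rewrite oppr_le0|rewrite mulr_ge0// exprn_ge0].
      rewrite inE /J /= in_itv/= => /andP[xj1 xj2]; rewrite mulr1.
      apply: (@le_trans _ _ (m * (1 + eta) ^+ n)); first by rewrite gerBl.
      have e0 : 0 <= 1 + eta by rewrite addr_ge0 ?(ltW eta0).
      have eq : 1 + eta <= 1 + (r ^+ 2 - (x - c) ^+ 2) / 4 by rewrite /eta; nra.
      apply: ler_pM; [exact: ltW|exact: exprn_ge0|exact: um|].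
      by apply: lerXn2r; rewrite ?nnegrE.
    case: (boolP (x \in J)) => [|_].
      rewrite inE /J /= in_itv/= => /andP[h1 h2].
      have h : a <= x <= b by apply/andP; split; [rewrite aE|rewrite bE]; lra.
      by rewrite h in xab.
    rewrite mulr0 sub0r lerNl; apply: le_trans (ler_norm _) _.
    rewrite normrN normrM ler_piMr// ger0_norm ?exprn_ge0// exprn_ile1//.
    by move: xab; rewrite negb_and -!ltNge aE bE => /orP[h|h]; nra.
  move: le; rewrite up RintegralB//.
  rewrite RintegralZl//; last first.
    apply: (integrableS measurableT mI (subsetT _)).
    exact: integrable_indic_itv.
  have -> : \int[mu]_(x in I) \1_J x = r.
    by rewrite /Rintegral integral_indic// setIidl//; move: muJ => /= ->.
  by rewrite subr_le0.
have mr0 : 0 < m * r by rewrite mulr_gt0.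
have K0 : 0 <= K / (m * r * eta).
  by rewrite divr_ge0 ?(ltW (mulr_gt0 _ _))// Rintegral_ge0.
have := archi_boundP K0; set N := Num.Def.archi_bound _ => KN.
have := bound N; apply/negP; rewrite -ltNge.
have mre0 : 0 < m * r * eta by exact: mulr_gt0.
have {}KN : K < N%:R * (m * r * eta) by move: KN; rewrite ltr_pdivrMr.
apply: lt_le_trans KN _.
have := bernoulli_inequality N (ltW eta0) => h.
have -> : N%:R * (m * r * eta) = m * r * (N%:R * eta) by ring.
by rewrite [leRHS]mulrAC ler_pM2l//; apply: le_trans h; rewrite lerDr.
Qed.

End Determinacy.

Section Uniqueness.
Context {R : realType}.
Notation mu := (@lebesgue_measure R).
Let I : set (measurableTypeR R) := `[-1, 1]%classic.
Let mI : measurable I. Proof. exact: measurable_itv. Qed.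
Variable kappa : nat.
Let lambda : R := sphere_order R (2 * kappa + 3).

(** [q] as a polynomial in x when it is given in the variable (1 - x)/2. *)
Definition half_shift (q : {poly R}) : {poly R} := q \Po (2^-1%:P * (1 - 'X)).

Lemma horner_half_shift q (x : R) : (half_shift q).[x] = q.[(1 - x) / 2].
Proof. by rewrite /half_shift horner_comp !hornerE mulrC. Qed.

Lemma gegen_lead_neq0 n : (gegen_poly kappa n)`_n != 0 :> R.
Proof.
rewrite coef_gegen_poly /gegen_coef !mulf_neq0 ?invr_eq0 ?mulf_neq0 ?fact_natr_neq0//.
- apply/prodf_neq0 => i _; rewrite addrC subr_eq0 eqr_nat.
  by rewrite ltn_eqF.
- by rewrite gt_eqF// pochhammer_gt0// addn1 ltr0Sn.
- by rewrite gt_eqF// pochhammer_gt0// ltr0Sn.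
Qed.

(** The Gegenbauer polynomials span all polynomials, having all degrees. *)
Lemma gegenbauer_moments_eq0 (u : R -> R) : mu.-integrable I (EFin \o u) ->
  (forall n, \int[mu]_(x in I) (u x * gegenbauer lambda n x) = 0) ->
  forall p : {poly R}, \int[mu]_(x in I) (u x * p.[x]) = 0.
Proof.
move=> ui un.
have half q : (forall x, u x * q.[(1 - x) / 2] = u x * (half_shift q).[x]).
  by move=> x; rewrite horner_half_shift.
have ih q : mu.-integrable I (EFin \o (fun x => u x * q.[(1 - x) / 2])).
  have := integrable_horner (half_shift q) ui.
  by apply: (eq_integrable mI) => x _; rewrite /= half.
have Tq n : forall q : {poly R}, (size q <= n)%N ->
    \int[mu]_(x in I) (u x * q.[(1 - x) / 2]) = 0.
  elim: n => [|n IH] q sq.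
    move: sq; rewrite leqn0 size_poly_eq0 => /eqP ->.
    under eq_Rintegral do rewrite horner0 mulr0.
    by rewrite Rintegral_cst// mul0r.
  pose F : {poly R} := gegen_poly kappa n.
  pose a := q`_n / F`_n.
  have s : (size (q - a *: F)%R <= n)%N.
    apply/leq_sizeP => j; rewrite leq_eqVlt => /predU1P[<-|nj].
      by rewrite coefB coefZ /a divfK ?subrr// gegen_lead_neq0.
    have sF : (size F <= j)%N by rewrite (leq_trans (size_poly _ _)).
    by rewrite coefB coefZ !nth_default ?mulr0 ?subr0// (leq_trans sq nj).
  have E x : u x * q.[(1 - x) / 2] =
      u x * (q - a *: F).[(1 - x) / 2] + a * (u x * F.[(1 - x) / 2]).
    by rewrite hornerD hornerN hornerZ; ring.
  under eq_Rintegral do rewrite E.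
  rewrite RintegralD//; last first.
    exact: (eq_integrable mI _ _ _ (integrableZl mI a (ih F))).
  rewrite (IH _ s) add0r RintegralZl//.
  under eq_Rintegral do rewrite -gegenbauerE.
  by rewrite un mulr0.
move=> p; have := Tq _ (p \Po (1 - 'X *+ 2)) (leqnn _).
congr (_ = 0); apply: eq_Rintegral => x _; congr (_ * _).
by rewrite horner_comp !hornerE; congr (_.[_]); field.
Qed.

Lemma integrable_spline_horner (k : R -> R) (n : nat) :
  mu.-integrable I (fun x => (k x * gegenbauer_weight lambda x)%:E) ->
  mu.-integrable I
    (EFin \o (fun x => k x * gegenbauer lambda n x * gegenbauer_weight lambda x)).
Proof.
move=> ki; have := integrable_horner (half_shift (gegen_poly kappa n)) ki.
apply: (eq_integrable mI) => x _.
by rewrite /= horner_half_shift -gegenbauerE mulrAC.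
Qed.

Lemma thinplate_spline_dot (k : R -> R) (n : nat) :
  is_thinplate_spline (2 * kappa + 3) k ->
  gegenbauer_dot lambda k (gegenbauer lambda n) =
  (if n == 0%N then 0 else
     (n%:R * (n%:R + (2 * kappa + 3)%:R - 2))^-1 * dim_harmonics R (2 * kappa + 3) n
     * gegenbauer_dot lambda (gegenbauer lambda n) (gegenbauer lambda n)).
Proof.
move=> [_ _ k0 kn]; case: n => [//|n] /=.
by rewrite -kn// divfK// gegenbauer_dot_norm_neq0.
Qed.

(** Otherwise k1 - k2 is bounded below by a positive constant on some interval
    [a, b] inside ]-1, 1[, where the weight is bounded below as well. *)
Lemma thinplate_spline_le (k1 k2 : R -> R) :
  is_thinplate_spline (2 * kappa + 3) k1 ->
  is_thinplate_spline (2 * kappa + 3) k2 ->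
  forall x, -1 <= x < 1 -> k1 x <= k2 x.
Proof.
move=> s1 s2 x0 x01; rewrite leNgt; apply/negP => k21.
have d12 n := etrans (thinplate_spline_dot n s1) (esym (thinplate_spline_dot n s2)).
case: s1 s2 => [c1 i1 _ _] [c2 i2 _ _].
pose u x := (k1 x - k2 x) * gegenbauer_weight lambda x.
have ui : mu.-integrable I (EFin \o u).
  apply: (eq_integrable mI _ _ _ (integrableB mI i1 i2)) => x _.
  by rewrite /u /= mulrBl EFinB.
have un n : \int[mu]_(x in I) (u x * gegenbauer lambda n x) = 0.
  have := d12 n; rewrite /gegenbauer_dot => /eqP; rewrite -subr_eq0 -RintegralB//;
    try exact: integrable_spline_horner.
  move=> /eqP <-; apply: eq_Rintegral => x _; rewrite /u; ring.
have up := gegenbauer_moments_eq0 ui un.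
have ch : {within `[-1, 1[, continuous (k1 - k2)}.
  exact: within_continuousB.
pose h := k1 x0 - k2 x0.
have h0 : 0 < h by rewrite subr_gt0.
have : \forall y \near within `[-1, 1[%classic (nbhs x0), h / 2 < (k1 - k2) y.
  move/subspace_continuousP : ch => /(_ x0 x01) chx.
  by apply: cvgr_gt chx _ _; change (h / 2 < h); lra.
rewrite near_withinE => /nbhs_ballP[e /= e0 be].
case/andP: x01 => x0N x01.
pose t := Num.min e (1 - x0).
have t0 : 0 < t by rewrite lt_min e0 subr_gt0.
have te : t <= e by rewrite ge_min lexx.
have tx : t <= 1 - x0 by rewrite ge_min lexx orbT.
pose a := x0 + t / 3; pose b := x0 + 2 * t / 3.
have ab1 : -1 < a /\ a < b /\ b < 1 by rewrite /a /b; split; [lra|split; lra].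
have [a1 [ab b1]] := ab1.
pose m := h / 2 * ((1 - b) * (1 + a)) ^+ kappa.
have v0 : 0 < (1 - b) * (1 + a) by rewrite mulr_gt0//; lra.
apply: (@moments_eq0_no_bump R u a b m) => //.
  by rewrite mulr_gt0 ?divr_gt0// exprn_gt0.
move=> x /andP[ax xb]; rewrite /m /u.
have hx : h / 2 < k1 x - k2 x.
  apply: be; rewrite /ball /=; last by rewrite in_itv/=; apply/andP; split; lra.
  by rewrite /a /b in ax xb *; rewrite ltr_norml; apply/andP; split; lra.
have xx : -1 <= x <= 1 by apply/andP; split; lra.
rewrite gegenbauer_weightE// /jacobi_weight horner_exp -exprMn.
apply: ler_pM; [by rewrite divr_ge0// ltW|by rewrite exprn_ge0// ltW|exact: ltW|].
have -> : 4 * ('X * (1 - 'X)).[(1 - x) / 2] = (1 - x) * (1 + x).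
  by rewrite !(hornerM, hornerD, hornerN, hornerC, hornerX); field.
have v1 : (1 - b) * (1 + a) <= (1 - x) * (1 + x).
  by apply: ler_pM; lra.
by apply: lerXn2r; rewrite ?nnegrE//; [exact: ltW|apply: le_trans v1; exact: ltW].
Qed.

Lemma thinplate_spline_unique (k1 k2 : R -> R) :
  is_thinplate_spline (2 * kappa + 3) k1 ->
  is_thinplate_spline (2 * kappa + 3) k2 ->
  forall x, -1 <= x < 1 -> k1 x = k2 x.
Proof.
move=> s1 s2 x x1; apply/eqP; rewrite eq_le.
by apply/andP; split; apply: thinplate_spline_le.
Qed.

End Uniqueness.

(** * Gamma integrals *)

Section GammaIntegral.
Context {R : realType}.
Notation mu := (@lebesgue_measure R).
Local Open Scope ereal_scope.

(** Extended-real values of [Gamma] and [weight_mass], to which Tonelli's theorem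
    applies before they are known to be finite. *)
Definition eGamma (a : R) : \bar R :=
  \int[mu]_(t in `]0%R, +oo[) (t `^ (a - 1) * expR (- t))%:E.

Definition eweight_mass (m : R) : \bar R :=
  \int[mu]_(y in `[(-1)%R, 1%R]) ((1 - y ^+ 2) `^ m)%:E.

Lemma measurable_gamma_fun (a : R) (D : set R) :
  measurable_fun D (fun t : R => (t `^ a * expR (- t))%R).
Proof.
apply: measurable_funTS; apply: measurable_funM; first exact: measurable_powR.
by apply: measurableT_comp => //; exact: measurable_expR.
Qed.

Lemma eGamma_ge0 (a : R) : 0 <= eGamma a.
Proof. by apply: integral_ge0 => t _; rewrite lee_fin mulr_ge0// powR_ge0. Qed.

Lemma integral_powR01 (a : R) : (0 < a)%R ->
  \int[mu]_(t in `]0%R, 1%R]) (t `^ (a - 1))%:E = (a^-1)%:E.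
Proof.
move=> a0; pose F (t : R) := (a^-1 * t `^ a)%R.
have dF (t : R) : (0 < t)%R -> is_derive t (1%R : R) F (t `^ (a - 1))%R.
  move=> t0; have -> : F = a^-1 \*: (@powR R ^~ a) by apply/funext.
  have dp := is_derive1_powR a t0.
  by apply: is_derive_eq; rewrite /GRing.scale /= mulKf// gt_eqF.
rewrite (ge0_FTC2_left_open (@ltr01 R) _ _ dF).
- by rewrite /F powR1 powR0 ?gt_eqF// mulr0 mulr1 subr0.
- move=> t t0; apply/differentiable_continuous/derivable1_diffP.
  by have [] := is_derive1_powR (a - 1) t0.
- by move=> t _; exact: powR_ge0.
- rewrite /F powR0 ?gt_eqF//; apply: cvgM; first exact: cvg_cst.
  exact: powR_cvg0.
Qed.

Lemma integral_expR_half1y :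
  \int[mu]_(t in `[1%R, +oo[) (expR (- (t / 2)))%:E < +oo.
Proof.
pose F (t : R) := (- 2 * expR (- (t / 2)))%R.
have dF (t : R) : is_derive t (1%R : R) F (expR (- (t / 2))).
  have -> : F = (- 2 : R)%R \*: (@expR R \o ((- 2^-1 : R)%R \*: @id R)).
    apply/funext => y; rewrite /F /= ?fctE /= /GRing.scale /=.
    by congr (_ * expR _)%R; ring.
  apply: is_derive_eq; rewrite /GRing.scale /= ?fctE /= /GRing.scale /=.
  have -> : (- 2^-1 * t = - (t / 2))%R by ring.
  by field.
have cF t : {for t, continuous F}.
  by apply/differentiable_continuous/derivable1_diffP; have [] := dF t.
rewrite (@ge0_continuous_FTC2y _ _ F _ 0%R) -?EFinB ?ltry//.
- apply: continuous_subspaceT => t.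
  apply: (@continuous_comp _ _ _ (fun t : R => - (t / 2))%R (@expR R)).
    by apply: cvgN; apply: cvgM; [exact: cvg_id|exact: cvg_cst].
  exact: continuous_expR.
- rewrite /F -[X in _ --> X](mulr0 (- 2)%R); apply: cvgM; first exact: cvg_cst.
  apply: (@cvg_comp _ _ _ (fun t : R => (t / 2)%R) (fun s : R => expR (- s)) _ (+oo%R)).
    by apply: (@gt0_cvgMly _ _ _ 2^-1%R id) => //; rewrite ?invr_gt0.
  exact: cvgr_expR.
- by apply: cvg_at_right_filter; exact: cF.
- by move=> t _; rewrite derive1E; exact: derive_val.
Qed.

(** The choice of d makes M d = 1/2, where M > `|a|; then a ln t <= M ln t and
    ln (d t) < d t give a ln t <= t/2 - M ln d. *)
Lemma gamma_fun_le (a : R) : exists C : R, (0 <= C)%R /\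
  forall t : R, (1 <= t)%R -> (t `^ a * expR (- t) <= C * expR (- (t / 2)))%R.
Proof.
pose M : R := (`|a| + 1)%R; pose d : R := (2 * M)^-1%R.
have M0 : (0 < M)%R by rewrite ltr_wpDl.
have d0 : (0 < d)%R by rewrite invr_gt0 mulr_gt0.
exists (expR (- (M * ln d))); split; first exact: expR_ge0.
move=> t t1; have t0 : (0 < t)%R by apply: lt_le_trans t1.
rewrite /powR gt_eqF// -!expRD ler_expR.
have lt0 : (0 <= ln t)%R by rewrite ln_ge0.
have aM : (a * ln t <= M * ln t)%R.
  by rewrite ler_wpM2r// /M (le_trans (ler_norm a))// lerDl.
have := ln_sublinear (mulr_gt0 d0 t0); rewrite lnM ?posrE// => h.
have : (M * (ln d + ln t) <= M * (d * t))%R by rewrite ler_pM2l// ltW.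
have -> : (M * (d * t) = t / 2)%R by rewrite /d; field; rewrite gt_eqF.
by rewrite mulrDr; move: aM; lra.
Qed.

Lemma eGamma_lty (a : R) : (0 < a)%R -> eGamma a < +oo.
Proof.
move=> a0; have [C [C0 hC]] := gamma_fun_le (a - 1).
have pos (t : R) : (0 <= t `^ (a - 1) * expR (- t))%R by rewrite mulr_ge0// powR_ge0.
have -> : eGamma a = \int[mu]_(t in `]0%R, 1%R]) (t `^ (a - 1) * expR (- t))%:E +
    \int[mu]_(t in `]1%R, +oo[) (t `^ (a - 1) * expR (- t))%:E.
  rewrite /eGamma (@itv_bndbnd_setU _ _ (BRight 0%R) (BRight 1%R) +oo%O)//.
  rewrite ge0_integral_setU//=.
  - by apply/measurable_EFinP; exact: measurable_gamma_fun.
  - by move=> t _; rewrite lee_fin.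
  - apply/disj_setPRL => t /=; rewrite !in_itv/= andbT => t1.
    by apply/negP; rewrite negb_and -!leNgt -ltNge t1 orbT.
  - by rewrite bnd_simp ler01.
apply: lte_add_pinfty.
  apply: (@le_lt_trans _ _ (\int[mu]_(t in `]0%R, 1%R]) (t `^ (a - 1))%:E)).
    apply: ge0_le_integral => //=.
    - by move=> t _; rewrite lee_fin.
    - by apply/measurable_EFinP; exact: measurable_gamma_fun.
    - by apply/measurable_EFinP; apply: measurable_funTS; exact: measurable_powR.
    - move=> t; rewrite in_itv/= lee_fin => /andP[/ltW t0 _].
      by rewrite ler_piMr ?powR_ge0// -expR0 ler_expR oppr_le0.
  by rewrite integral_powR01// ltry.
have mC : measurable_fun (`]1%R, +oo[%classic : set R)
    (fun t : R => (C * expR (- (t / 2)))%:E).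
  apply/measurable_EFinP; apply: measurable_funTS; apply: measurable_funM => //.
  by apply: measurableT_comp; [exact: measurable_expR|apply: measurableT_comp => //;
    exact: measurable_funM].
apply: (@le_lt_trans _ _ (\int[mu]_(t in `]1%R, +oo[) (C * expR (- (t / 2)))%:E)).
  apply: ge0_le_integral => //=.
  - by move=> t _; rewrite lee_fin.
  - by apply/measurable_EFinP; exact: measurable_gamma_fun.
  - move=> t; rewrite in_itv/= andbT lee_fin => /ltW; exact: hC.
rewrite integral_itv_obnd_cbnd//.
under eq_integral do rewrite EFinM.
rewrite ge0_integralZl_EFin//.
- by apply: lte_mul_pinfty => //; exact: integral_expR_half1y.
- apply/measurable_EFinP; apply: measurable_funTS.
  by apply: measurableT_comp; [exact: measurable_expR|apply: measurableT_comp => //;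
    exact: measurable_funM].
Qed.

Lemma eGamma_gt0 (a : R) : 0 < eGamma a.
Proof.
pose m : R := expR (- (`|a - 1| + 2))%R.
have m0 : (0 < m)%R by exact: expR_gt0.
apply: (@lt_le_trans _ _ (\int[mu]_(t in `[1%R, 2%R]) m%:E)).
  rewrite integral_cst ?measurable_itv//= lebesgue_measure_itv /= lte_fin ltr1n.
  by rewrite -EFinB -EFinM lte_fin mulr_gt0// subr_gt0 ltr1n.
apply: (@le_trans _ _ (\int[mu]_(t in `[1%R, 2%R]) (t `^ (a - 1) * expR (- t))%:E)).
  apply: ge0_le_integral => //=.
  - by move=> t _; rewrite lee_fin ltW.
  - by apply/measurable_EFinP; exact: measurable_gamma_fun.
  - move=> t; rewrite in_itv/= lee_fin => /andP[t1 t2].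
    have t0 : (0 < t)%R by apply: lt_le_trans t1.
    rewrite /powR gt_eqF// -expRD ler_expR.
    have l0 : (0 <= ln t)%R by rewrite ln_ge0.
    have l1 : (ln t <= 1)%R.
      have /le_ln1Dx : (-1 < t - 1)%R by lra.
      by rewrite addrC subrK; lra.
    have : (- (`|a - 1| * ln t) <= (a - 1) * ln t)%R.
      by rewrite -mulNr ler_wpM2r// lerNl -normrN ler_norm.
    have : (`|a - 1| * ln t <= `|a - 1|)%R by rewrite ler_piMr.
    by lra.
apply: ge0_subset_integral => //=.
- by apply/measurable_EFinP; exact: measurable_gamma_fun.
- by move=> t _; rewrite lee_fin mulr_ge0// powR_ge0.
- by move=> t; rewrite /= !in_itv/= andbT => /andP[t1 _]; apply: lt_le_trans t1.
Qed.

End GammaIntegral.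

(** * The mass of the weight *)

Section WeightMass.
Context {R : realType}.
Notation mu := (@lebesgue_measure R).
Local Open Scope ereal_scope.

(** The product exp(- t) t^m exp(- x^2) in the coordinates r = t + x^2 and x. *)
Definition joint_density (m : R) (z : measurableTypeR R * measurableTypeR R) : \bar R :=
  (if (z.2 ^+ 2 < z.1)%R then ((z.1 - z.2 ^+ 2) `^ m * expR (- z.1))%R else 0%R)%:E.

Lemma joint_density_ge0 (m : R) z : 0 <= joint_density m z.
Proof.
rewrite /joint_density lee_fin; case: ifP => // _.
by rewrite mulr_ge0 ?powR_ge0 ?expR_ge0.
Qed.

Lemma measurable_joint_density (m : R) : measurable_fun setT (joint_density m).
Proof.
apply/measurable_EFinP; apply: measurable_fun_ifT.
- apply: measurable_fun_ltr; first exact: measurable_funX.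
  exact: measurable_fst.
- apply: measurable_funM.
    apply: (measurableT_comp (measurable_powR m)).
    by apply: measurable_funB; [exact: measurable_fst|exact: measurable_funX].
  apply: (measurableT_comp (@measurable_expR R)).
  by apply: measurableT_comp => //; exact: measurable_fst.
- exact: measurable_cst.
Qed.

(** Substitute r = t + x^2. *)
Lemma integral_joint_density1 m (x : R) :
  \int[mu]_r joint_density m (r, x) = (expR (- x ^+ 2))%:E * eGamma (m + 1).
Proof.
transitivity (\int[mu]_(r in `](x ^+ 2)%R, +oo[) ((r - x ^+ 2) `^ m * expR (- r))%:E).
  rewrite [RHS]integral_mkcond; apply: eq_integral => r _.
  rewrite patchE /joint_density /=; case: ifPn => h.
    by rewrite mem_set//= in_itv/= h.
  by rewrite memNset//= in_itv/= andbT; exact/negP.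
rewrite (@ge0_integral_affine _ 1 (x ^+ 2)%R _ _ (oner_neq0 R)); last 3 first.
- exact: measurable_itv.
- apply/measurable_EFinP; apply: measurable_funTS; apply: measurable_funM.
    apply: (measurableT_comp (measurable_powR m)).
    by apply: measurable_funB; [exact: measurable_id|exact: measurable_cst].
  by apply: measurableT_comp => //; exact: measurable_expR.
- by move=> r _; rewrite lee_fin mulr_ge0 ?powR_ge0 ?expR_ge0.
have -> : [set r : R | `](x ^+ 2)%R, +oo[%classic (1 * r + x ^+ 2)%R] = `]0%R, +oo[%classic.
  by apply/seteqP; split => r; rewrite /= !in_itv/= !andbT mul1r ltrDr.
rewrite normr1 mul1e /eGamma -ge0_integralZl; last 4 first.
- exact: measurable_itv.
- by apply/measurable_EFinP; exact: measurable_gamma_fun.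
- by move=> r _; rewrite lee_fin mulr_ge0 ?powR_ge0 ?expR_ge0.
- by rewrite lee_fin expR_ge0.
apply: eq_integral => r _; rewrite -EFinM mul1r addrK opprD expRD addrK; congr EFin.
by ring.
Qed.

(** Substitute x = sqrt r * y. *)
Lemma integral_joint_density2 m (r : R) : (0 < r)%R ->
  \int[mu]_x joint_density m (r, x) =
  (r `^ (m + 3 / 2 - 1) * expR (- r))%:E * eweight_mass m.
Proof.
move=> r0; set s := Num.sqrt r.
have s0 : (0 < s)%R by rewrite sqrtr_gt0.
have s2 : (s ^+ 2 = r)%R by rewrite sqr_sqrtr// ltW.
transitivity (\int[mu]_(x in `](- s)%R, s[) ((r - x ^+ 2) `^ m * expR (- r))%:E).
  rewrite [RHS]integral_mkcond; apply: eq_integral => x _.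
  rewrite patchE /joint_density /=.
  have -> : ((x ^+ 2 < r) = (- s < x < s))%R.
    rewrite -s2 -ltr_norml -(real_normK (num_real x)) ltr_pXn2r ?nnegrE//.
    exact: ltW.
  case: ifPn => h; first by rewrite mem_set//= in_itv/= h.
  by rewrite memNset//= in_itv/=; exact/negP.
have mf (c : R) : measurable_fun [set: R] (fun x : R => ((c - x ^+ 2) `^ m)%R).
  apply: (measurableT_comp (measurable_powR m)).
  by apply: measurable_funB => //; exact: measurable_funX.
have sn0 : s != 0%R by rewrite gt_eqF.
rewrite (@ge0_integral_affine _ s 0%R _ _ sn0); last 3 first.
- exact: measurable_itv.
- by apply/measurable_EFinP; apply: measurable_funTS; apply: measurable_funM.
- by move=> x _; rewrite lee_fin mulr_ge0 ?powR_ge0 ?expR_ge0.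
have -> : [set x : R | `](- s)%R, s[%classic (s * x + 0)%R] = `](-1)%R, 1%R[%classic.
  apply/seteqP; split => x; rewrite /= !in_itv/= addr0 => /andP[h1 h2].
    by apply/andP; split; nra.
  by apply/andP; split; nra.
rewrite /eweight_mass [X in _ = _ * X]integral_itv_bndoo; last first.
  by apply/measurable_EFinP; apply: measurable_funTS; exact: mf.
rewrite -ge0_integralZl; last 4 first.
- exact: measurable_itv.
- apply/measurable_EFinP; apply: measurable_funTS; apply: measurable_funM => //.
  apply: (measurableT_comp (mf r)).
  by apply: measurable_funD => //; exact: measurable_funM.
- by move=> x _; rewrite lee_fin mulr_ge0 ?powR_ge0 ?expR_ge0.
- by rewrite lee_fin.
rewrite -ge0_integralZl; last 4 first.
- exact: measurable_itv.
- by apply/measurable_EFinP; apply: measurable_funTS; exact: mf.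
- by move=> x _; rewrite lee_fin powR_ge0.
- by rewrite lee_fin mulr_ge0 ?powR_ge0 ?expR_ge0.
apply: eq_integral => x; rewrite inE /= in_itv/= => /andP[x1 x2].
rewrite -!EFinM addr0; congr EFin.
have -> : (r - (s * x) ^+ 2 = r * (1 - x ^+ 2))%R by rewrite exprMn s2; ring.
rewrite powRM ?(ltW r0)//; last nra.
have -> : (m + 3 / 2 - 1 = m + 2^-1)%R by field.
rewrite powRD; last by rewrite (gt_eqF r0) implybT.
rewrite powR12_sqrt ?(ltW r0)// -/s gtr0_norm//.
by ring.
Qed.

Lemma eweight_mass_ge0 (m : R) : 0 <= eweight_mass m.
Proof. by apply: integral_ge0 => x _; rewrite lee_fin powR_ge0. Qed.

(** The two iterated integrals of [joint_density] are equal by Tonelli's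
    theorem. *)
Lemma eweight_mass_gamma (m : R) :
  eGamma (m + 3 / 2) * eweight_mass m = (Num.sqrt pi)%:E * eGamma (m + 1).
Proof.
have := @fubini_tonelli _ _ _ _ _ mu mu _ (measurable_joint_density m)
  (joint_density_ge0 m).
under [X in _ = X -> _]eq_integral do rewrite integral_joint_density1.
rewrite ge0_integralZr; last 4 first.
- exact: measurableT.
- apply/measurable_EFinP; exact: measurable_gauss_fun.
- by move=> x _; rewrite lee_fin expR_ge0.
- exact: eGamma_ge0.
have := @integralT_gauss R; rewrite /gauss_fun => -> <-.
rewrite /eGamma -ge0_integralZr; last 4 first.
- exact: measurable_itv.
- by apply/measurable_EFinP; exact: measurable_gamma_fun.
- by move=> r _; rewrite lee_fin mulr_ge0 ?powR_ge0 ?expR_ge0.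
- exact: eweight_mass_ge0.
rewrite [LHS]integral_mkcond; apply: eq_integral => r _; rewrite patchE.
case: ifPn => [|]; rewrite ?inE ?notin_setE /= in_itv/= andbT => r0.
  by rewrite integral_joint_density2.
apply/esym; apply: integral0_eq => x _; rewrite /joint_density /= ifF//.
apply/negbTE; rewrite -leNgt (le_trans _ (sqr_ge0 x))// leNgt; exact/negP.
Qed.

Lemma weight_mass_gamma (m : R) : (-1 < m)%R ->
  weight_mass m = (Num.sqrt pi * Gamma (m + 1) / Gamma (m + 3 / 2))%R.
Proof.
move=> m1; have := eweight_mass_gamma m.
have fin (a : R) : (0 < a)%R -> eGamma a = (Gamma a)%:E.
  move=> a0; rewrite /Gamma /Rintegral fineK//.
  by rewrite ge0_fin_numE ?eGamma_ge0 ?eGamma_lty.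
have pos (a : R) : (0 < a)%R -> (0 < Gamma a)%R.
  by move=> a0; rewrite -lte_fin -fin// eGamma_gt0.
have a0 : (0 < m + 1)%R by lra.
have b0 : (0 < m + 3 / 2)%R by lra.
rewrite !fin//; have := pos _ b0; move: (Gamma (m + 1)) (Gamma (m + 3 / 2)) => a b bp.
rewrite /weight_mass /Rintegral -/(eweight_mass m) => e.
have : eweight_mass m = (Num.sqrt pi * a / b)%:E.
  have := congr1 (fun y => b^-1%:E * y) e.
  rewrite /= muleA -EFinM mulVf ?gt_eqF// mul1e => ->.
  by rewrite -!EFinM mulrC.
by move=> ->.
Qed.

End WeightMass.

(** * The thinplate spline *)

Theorem mainTheorem3 (R : realType) (kappa : nat) :
  (forall k : R -> R,
     is_thinplate_spline (2 * kappa + 3) k <->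
     (forall x : R, -1 <= x < 1 ->
        k x = -1 / ((2 * kappa + 1)%N)%:R * ln ((1 - x) / 2)
              + \sum_(1 <= nu < kappa.+1) spline_coef R kappa nu * (1 - x) ^- nu
              - spline_const R kappa)) /\
  (forall mu : R, -1 < mu ->
     weight_mass mu = Num.sqrt pi * Gamma (mu + 1) / Gamma (mu + 3 / 2)).
Proof.
split=> [k|]; last exact: weight_mass_gamma.
split=> [sk|]; last exact: thinplate_spline_of_formula.
exact: thinplate_spline_unique sk
  (@thinplate_spline_of_formula R kappa _ (fun _ _ => erefl)).
Qed.
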